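(* Let $\{C_k\}_{k\ge 0},\{D_k\}_{k\ge 0},\{Y_k\}_{k\ge 0},\{\mu_k\}_{k\ge 0}$ be the sequences generated by the WSVT iteration (defined in the context) for a data matrix $X\in\mathbb{R}^{m\times n}$, a non-singular weight matrix $W\in\mathbb{R}^{n\times n}$, and parameters $\tau>0$, $\rho>1$, $\mu_0>0$. Let $(C_\infty,D_\infty)$ be the limit point of $(C_k,D_k)$ and define $$f_\infty=\tfrac12\|XW-C_\infty\|_F^2+\tau\|D_\infty\|_* .$$ Then $C_\infty=D_\infty W$ and, for $k=1,2,\dots$, $$-O(\mu_{k-1}^{-2})\le \tfrac12\|XW-C_k\|_F^2+\tau\|D_k\|_*-f_\infty\le O(\mu_{k-1}^{-1}).$$
   Context: $\|\cdot\|_F$ is the Frobenius norm, $\|\cdot\|_*$ the nuclear norm (sum of singular values), $\langle A,B\rangle=\mathrm{tr}(A^TB)$. $O(\mu_{k-1}^{-p})$ denotes a nonnegative quantity bounded by a constant independent of $k$ times $\mu_{k-1}^{-p}$. Augmented Lagrangian: for $C,D,Y\in\mathbb{R}^{m\times n}$ and $\mu>0$, $$L(C,D,Y,\mu)=\tfrac12\|XW-C\|_F^2+\tau\|D\|_*+\langle Y,D-CW^{-1}\rangle+\tfrac{\mu}{2}\|D-CW^{-1}\|_F^2 .$$ WSVT iteration: initialize $C_0=XW$, $D_0=X$, $Y_0=0$, $\mu_0>0$. For $k=0,1,2,\dots$ set $$C_{k+1}=\arg\min_C L(C,D_k,Y_k,\mu_k)=\big(XW+\mu_kD_k(W^{-1})^T+Y_k(W^{-1})^T\big)\big(I_n+\mu_k(W^TW)^{-1}\big)^{-1},$$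 $$D_{k+1}=\arg\min_D L(C_{k+1},D,Y_k,\mu_k)=U_kS_{\tau/\mu_k}(\Sigma_k)V_k^T,$$ where $U_k\Sigma_kV_k^T$ is a singular value decomposition of $C_{k+1}W^{-1}-\frac1{\mu_k}Y_k$ and $S_t(x)=\mathrm{sign}(x)\max(|x|-t,0)$ is applied entrywise; and $$Y_{k+1}=Y_k+\mu_k(D_{k+1}-C_{k+1}W^{-1}),\qquad \mu_{k+1}=\rho\mu_k .$$ The iteration is run indefinitely (no stopping criterion). The sequences $\{C_k\}$ and $\{D_k\}$ are known to converge, so that $(C_\infty,D_\infty)=\lim_{k\to\infty}(C_k,D_k)$ exists. *)

(* Defs.v *)
(* MathComp / MathComp-Analysis *)
From mathcomp Require Import all_boot all_order all_algebra.
From mathcomp Require Import polyrcf.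
From mathcomp Require Import all_classical all_reals all_analysis.

Set Implicit Arguments.
Unset Strict Implicit.
Unset Printing Implicit Defensive.

Import Order.TTheory GRing.Theory Num.Theory.
Import numFieldNormedType.Exports.
Local Open Scope classical_set_scope.
Local Open Scope ring_scope.

Section MatrixNorms.
Variable R : realType.

Definition mxinner (m n : nat) (A B : 'M[R]_(m, n)) : R := \tr (A^T *m B).

Definition frobenius_norm (m n : nat) (A : 'M[R]_(m, n)) : R :=
  Num.sqrt (\sum_i \sum_j A i j ^+ 2).

(* The square roots of the n eigenvalues of A^T A, listed with their
   multiplicity.  When m < n, at least n - m of them are zero and do not
   contribute to the nuclear norm. *)
Definition singular_values (m n : nat) (A : 'M[R]_(m, n)) : seq R :=
  let p := char_poly (A^T *m A) in
  flatten [seq nseq (mup s p) (Num.sqrt s) | s <- rootsR p].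

Definition nuclear_norm (m n : nat) (A : 'M[R]_(m, n)) : R :=
  \sum_(s <- singular_values A) s.

(* A full singular value decomposition A = U Sigma V^T: the orthogonal factors
   are square and Sigma is rectangular diagonal.  No order is imposed on the
   diagonal of Sigma. *)
Definition is_svd (m n : nat) (A : 'M[R]_(m, n))
    (U : 'M[R]_m) (Sigma : 'M[R]_(m, n)) (V : 'M[R]_n) : Prop :=
  [/\ U^T *m U = 1%:M,
      V^T *m V = 1%:M,
      (forall (i : 'I_m) (j : 'I_n), (i != j :> nat) -> Sigma i j = 0),
      (forall (i : 'I_m) (j : 'I_n), 0 <= Sigma i j)
    & A = U *m Sigma *m V^T].

Definition soft_threshold (t x : R) : R :=
  Num.sg x * Num.max (`|x| - t) 0.

Definition is_minimizer (T : Type) (f : T -> R) (x : T) : Prop :=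
  forall y, f x <= f y.

End MatrixNorms.

Section WSVT.
Variables (R : realType) (m n : nat).
Variables (X : 'M[R]_(m, n)) (W : 'M[R]_n) (tau : R).

Definition objective (C D : 'M[R]_(m, n)) : R :=
  2^-1 * frobenius_norm (X *m W - C) ^+ 2 + tau * nuclear_norm D.

Definition aug_lagrangian (C D Y : 'M[R]_(m, n)) (mu : R) : R :=
  objective C D + mxinner Y (D - C *m invmx W)
  + mu / 2 * frobenius_norm (D - C *m invmx W) ^+ 2.

(* Each of the updates of C and D is given, as usual, both as the minimizer of
   the augmented Lagrangian (a strictly convex problem, so the minimizer is
   unique) and in closed form.  Any singular value decomposition may be used at
   each step. *)
Record wsvt_iteration (rho : R) (C D Y : nat -> 'M[R]_(m, n)) (mu : nat -> R)
    : Prop := WsvtIteration {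
  wsvt_C0 : C 0%N = X *m W;
  wsvt_D0 : D 0%N = X;
  wsvt_Y0 : Y 0%N = 0;
  wsvt_C_min : forall k,
    is_minimizer (fun C' => aug_lagrangian C' (D k) (Y k) (mu k)) (C k.+1);
  wsvt_C_eq : forall k,
    C k.+1 =
      (X *m W + mu k *: (D k *m (invmx W)^T) + Y k *m (invmx W)^T)
      *m invmx (1%:M + mu k *: invmx (W^T *m W));
  wsvt_D_min : forall k,
    is_minimizer (fun D' => aug_lagrangian (C k.+1) D' (Y k) (mu k)) (D k.+1);
  wsvt_D_eq : forall k, exists U Sigma V,
    is_svd (C k.+1 *m invmx W - (mu k)^-1 *: Y k) U Sigma V /\
    D k.+1 = U *m map_mx (soft_threshold (tau / mu k)) Sigma *m V^T;
  wsvt_Y_eq : forall k,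
    Y k.+1 = Y k + mu k *: (D k.+1 - C k.+1 *m invmx W);
  wsvt_mu_eq : forall k, mu k.+1 = rho * mu k
}.

End WSVT.

(* Main.v *)
Require Import Defs.
From mathcomp Require Import all_boot all_order all_algebra.
From mathcomp Require Import polyrcf.
From mathcomp Require Import all_classical all_reals all_analysis.
From mathcomp Require Import ring lra.

Set Implicit Arguments.
Unset Strict Implicit.
Unset Printing Implicit Defensive.

Import Order.TTheory GRing.Theory Num.Theory.
Import numFieldNormedType.Exports.
Local Open Scope classical_set_scope.
Local Open Scope ring_scope.

(** The iteration alternates two exact proximal steps, and everything follows
    from the first-order conditions of these steps.  Write [B_k = C_k W^-1],
    [H_k = (C_k - X W) W^T] (the gradient of the quadratic term, seen from the
    variable [C W^-1]), [G_k = H_k - Y_k] and [d_k = 1 / mu_k].  The two updates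
    say that
      - [-Y_(k+1)] lies in the ball dual to the nuclear norm scaled by [tau],
        and norms [D_(k+1)]:
        [tau |D_(k+1)|_* = - <Y_(k+1), D_(k+1)>] ([soft_threshold_dual]);
      - [D_(k+1) - B_(k+1) = d_k (Y_(k+1) - Y_k)] and
        [D_k - D_(k+1) = d_k G_(k+1)].
    So [Y] is bounded, all increments are [O(d_k)], and since [d_k] is geometric
    the distances from [C_k] and [D_k] to their limits are [O(d_k)] too.

    Passing to the limit in the duality inequalities needs the nuclear norm,
    defined through roots of a characteristic polynomial, to be continuous along
    [D_k].  This is [nuclear_norm_cvg]: the orthogonal factors of the given
    singular value decompositions converge along any ultrafilter, and their
    limit diagonalizes the limit.

    Let [f_k] be the objective at step [k].  The upper bound on [f_k - f_oo] is
    convexity of the nuclear norm at [D_k].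

    The lower bound is more delicate, because the limit need not be optimal and
    convergence of [Y] is not granted.  Convexity at step [k + 1] gives the descent
    inequality
      [f_k - f_(k+1) >= d_k |G_(k+1)|^2 - <H_(k+1), E_k - E_(k+1)>],
    with [E_k = D_k - B_k].  Its last term telescopes up to [O(d_k^2)], so that
      [f_k - f_oo >= d_k |G_(k+1)|^2 - <H_oo, E_k> - O(d_(k-1)^2)],
    where [E_k = d_(k-1) (Y_k - Y_(k-1))]: it remains to see that
    [Y_k - Y_(k-1)] is dominated by [|G_(k+1)|^2] up to [O(d_k)].  Monotonicity
    of the subdifferential ([gap_monotone]) shows that [|G_k|^2] decreases up to
    [O(d_k)] and that [G_(k+1) - G_k] tends to 0.  Hence there are two cases.
      - If [|G_k|] tends to a positive limit, [d_k |G_(k+1)|^2] eventually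
        dominates [d_(k-1) |Y_k - Y_(k-1)|].
      - If [G_k] tends to 0, then [Y_k] tends to [H_oo].  Here the boundary of
        the dual ball is curved enough ([nuclear_curvature]) to force
        [|G_(k+1)| <= K (|G_k|^2 + d_(k-1))], a quadratic contraction, whence
        [G_k = O(d_k)] and [Y_k - Y_(k-1) = O(d_k)]. *)

(** * The Frobenius inner product *)

Section FrobeniusInnerProduct.
Variable R : realType.
Implicit Types m n p : nat.

Lemma mxinnerE m n (A B : 'M[R]_(m, n)) :
  mxinner A B = \sum_i \sum_j A i j * B i j.
Proof.
rewrite /mxinner /mxtrace exchange_big /=; apply: eq_bigr => j _.
by rewrite mxE; apply: eq_bigr => i _; rewrite mxE.
Qed.

Lemma mxinnerC m n (A B : 'M[R]_(m, n)) : mxinner A B = mxinner B A.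
Proof.
by rewrite !mxinnerE; do 2![apply: eq_bigr => ? _]; rewrite mulrC.
Qed.

Lemma mxinnerDr m n (A B C : 'M[R]_(m, n)) :
  mxinner A (B + C) = mxinner A B + mxinner A C.
Proof. by rewrite /mxinner mulmxDr mxtraceD. Qed.

Lemma mxinnerZr m n a (A B : 'M[R]_(m, n)) :
  mxinner A (a *: B) = a * mxinner A B.
Proof. by rewrite /mxinner -scalemxAr mxtraceZ. Qed.

Lemma mxinnerNr m n (A B : 'M[R]_(m, n)) : mxinner A (- B) = - mxinner A B.
Proof. by rewrite -scaleN1r mxinnerZr mulN1r. Qed.

Lemma mxinnerBr m n (A B C : 'M[R]_(m, n)) :
  mxinner A (B - C) = mxinner A B - mxinner A C.
Proof. by rewrite mxinnerDr mxinnerNr. Qed.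

Lemma mxinnerDl m n (A B C : 'M[R]_(m, n)) :
  mxinner (B + C) A = mxinner B A + mxinner C A.
Proof. by rewrite mxinnerC mxinnerDr !(mxinnerC A). Qed.

Lemma mxinnerZl m n a (A B : 'M[R]_(m, n)) :
  mxinner (a *: B) A = a * mxinner B A.
Proof. by rewrite mxinnerC mxinnerZr (mxinnerC A). Qed.

Lemma mxinnerNl m n (A B : 'M[R]_(m, n)) : mxinner (- B) A = - mxinner B A.
Proof. by rewrite mxinnerC mxinnerNr (mxinnerC A). Qed.

Lemma mxinnerBl m n (A B C : 'M[R]_(m, n)) :
  mxinner (B - C) A = mxinner B A - mxinner C A.
Proof. by rewrite mxinnerDl mxinnerNl. Qed.

Lemma mxinner_sumr m n (I : finType) (A : 'M[R]_(m, n)) (F : I -> 'M[R]_(m, n)) :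
  mxinner A (\sum_i F i) = \sum_i mxinner A (F i).
Proof. by rewrite /mxinner mulmx_sumr raddf_sum. Qed.

Definition mxinner_lin :=
  (mxinnerBr, mxinnerBl, mxinnerDr, mxinnerDl, mxinnerNr, mxinnerNl,
   mxinnerZr, mxinnerZl).

(** With [mxinnerMr]: left and right multiplications have their transposes as
    adjoints. *)
Lemma mxinnerMl m n p (A : 'M[R]_(m, n)) (B : 'M[R]_(n, p)) (C : 'M[R]_(m, p)) :
  mxinner (A *m B) C = mxinner B (A^T *m C).
Proof. by rewrite /mxinner trmx_mul mulmxA. Qed.

Lemma mxinnerMr m n p (A : 'M[R]_(m, n)) (B : 'M[R]_(n, p)) (C : 'M[R]_(m, p)) :
  mxinner (A *m B) C = mxinner A (C *m B^T).
Proof.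
by rewrite /mxinner trmx_mul -mulmxA mxtrace_mulC mulmxA.
Qed.

Lemma mxinnerT m n (A B : 'M[R]_(m, n)) : mxinner A^T B^T = mxinner A B.
Proof. by rewrite /mxinner trmxK mxtrace_mulC -mxtrace_tr trmx_mul trmxK. Qed.

Lemma mxinner_ge0 m n (A : 'M[R]_(m, n)) : 0 <= mxinner A A.
Proof.
by rewrite mxinnerE; do 2![apply: sumr_ge0 => ? _]; rewrite -expr2 sqr_ge0.
Qed.

Lemma frobenius_ge0 m n (A : 'M[R]_(m, n)) : 0 <= frobenius_norm A.
Proof. exact: sqrtr_ge0. Qed.
Hint Resolve frobenius_ge0 : core.

Lemma frobenius_sqr m n (A : 'M[R]_(m, n)) :
  frobenius_norm A ^+ 2 = mxinner A A.
Proof.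
rewrite /frobenius_norm sqr_sqrtr; last first.
  by do 2![apply: sumr_ge0 => ? _]; rewrite sqr_ge0.
by rewrite mxinnerE.
Qed.

Lemma frobeniusN m n (A : 'M[R]_(m, n)) : frobenius_norm (- A) = frobenius_norm A.
Proof. by apply/eqP; rewrite -(@eqrXn2 _ 2) // !frobenius_sqr !mxinner_lin opprK. Qed.

Lemma frobeniusBC m n (A B : 'M[R]_(m, n)) :
  frobenius_norm (A - B) = frobenius_norm (B - A).
Proof. by rewrite -frobeniusN opprB. Qed.

Lemma frobeniusZ m n a (A : 'M[R]_(m, n)) :
  frobenius_norm (a *: A) = `|a| * frobenius_norm A.
Proof.
apply/eqP; rewrite -(@eqrXn2 _ 2) ?mulr_ge0 // exprMn !frobenius_sqr !mxinner_lin.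
by rewrite mulrA -expr2 real_normK ?num_real.
Qed.

Lemma frobeniusT m n (A : 'M[R]_(m, n)) : frobenius_norm A^T = frobenius_norm A.
Proof. by apply/eqP; rewrite -(@eqrXn2 _ 2) // !frobenius_sqr mxinnerT. Qed.

(** Cauchy-Schwarz, from [0 <= |a B - b A|^2] with [a = |A|], [b = |B|]. *)
Lemma mxinner_le_frobenius m n (A B : 'M[R]_(m, n)) :
  mxinner A B <= frobenius_norm A * frobenius_norm B.
Proof.
set a := frobenius_norm A; set b := frobenius_norm B.
have a0 : 0 <= a by exact: frobenius_ge0.
have b0 : 0 <= b by exact: frobenius_ge0.
have H (M N : 'M[R]_(m, n)) : frobenius_norm N = 0 -> mxinner M N = 0.
  move=> N0; have /eqP : mxinner N N = 0 by rewrite -frobenius_sqr N0 expr0n.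
  rewrite mxinnerE psumr_eq0 => [/allP N1|i _]; last first.
    by apply: sumr_ge0 => j _; rewrite -expr2 sqr_ge0.
  rewrite mxinnerE big1 // => i _; rewrite big1 // => j _.
  have := N1 i (mem_index_enum _); rewrite psumr_eq0 => [/allP N2|k _].
    by have := N2 j (mem_index_enum _); rewrite mulf_eq0 orbb => /eqP ->; rewrite mulr0.
  by rewrite -expr2 sqr_ge0.
have [/eqP a1|a1] := boolP (a == 0); first by rewrite mxinnerC (H B A a1) a1 mul0r.
have [/eqP b1|b1] := boolP (b == 0); first by rewrite (H A B b1) b1 mulr0.
have ab : 0 < a * b by rewrite mulr_gt0 // lt_neqAle eq_sym ?a1 ?b1.
have := mxinner_ge0 (a *: B - b *: A).
rewrite !mxinner_lin (mxinnerC B A) -!frobenius_sqr -/a -/b => h.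
rewrite -(ler_pM2l ab); nra.
Qed.

Lemma normr_mxinner_le m n (A B : 'M[R]_(m, n)) :
  `|mxinner A B| <= frobenius_norm A * frobenius_norm B.
Proof.
rewrite ler_norml mxinner_le_frobenius andbT lerNl -mxinnerNl.
by rewrite -(frobeniusN A) mxinner_le_frobenius.
Qed.

Lemma frobeniusD m n (A B : 'M[R]_(m, n)) :
  frobenius_norm (A + B) <= frobenius_norm A + frobenius_norm B.
Proof.
rewrite -(@ler_pXn2r _ 2) ?nnegrE ?addr_ge0 // frobenius_sqr !mxinner_lin.
rewrite (mxinnerC B A) -!frobenius_sqr sqrrD.
have := mxinner_le_frobenius A B; lra.
Qed.

Lemma frobeniusB m n (A B : 'M[R]_(m, n)) :
  frobenius_norm (A - B) <= frobenius_norm A + frobenius_norm B.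
Proof. by rewrite -(frobeniusN B) frobeniusD. Qed.

Lemma frobenius_triangle m n (B A C : 'M[R]_(m, n)) :
  frobenius_norm (A - C) <= frobenius_norm (A - B) + frobenius_norm (B - C).
Proof. by rewrite -[A in A - C](subrK B) -addrA frobeniusD. Qed.

Lemma frobeniusM m n p (A : 'M[R]_(m, n)) (B : 'M[R]_(n, p)) :
  frobenius_norm (A *m B) <= frobenius_norm A * frobenius_norm B.
Proof.
rewrite -(@ler_pXn2r _ 2) ?nnegrE ?mulr_ge0 // exprMn !frobenius_sqr.
rewrite -(mxinnerT B) !mxinnerE mulr_suml; apply: ler_sum => i _.
rewrite mulr_sumr; apply: ler_sum => j _.
have h := normr_mxinner_le (row i A) (row j B^T).
have {}h : mxinner (row i A) (row j B^T) ^+ 2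
    <= mxinner (row i A) (row i A) * mxinner (row j B^T) (row j B^T).
  by rewrite -!frobenius_sqr -exprMn -real_normK ?num_real // ler_pXn2r ?nnegrE ?mulr_ge0.
rewrite -expr2 mxE (eq_bigr (fun k => A i k * B k j)) //.
move: h; rewrite !mxinnerE !big_ord1.
have ->: \sum_j0 row i A 0 j0 * row j B^T 0 j0 = \sum_k A i k * B k j.
  by apply: eq_bigr => k _; rewrite !mxE.
have ->: \sum_j0 row i A 0 j0 * row i A 0 j0 = \sum_k A i k * A i k.
  by apply: eq_bigr => k _; rewrite !mxE.
have -> //: \sum_j0 row j B^T 0 j0 * row j B^T 0 j0 = \sum_k B^T j k * B^T j k.
by apply: eq_bigr => k _; rewrite !mxE.
Qed.

Lemma entry_le_frobenius m n (A : 'M[R]_(m, n)) i j :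
  `|A i j| <= frobenius_norm A.
Proof.
rewrite -(@ler_pXn2r _ 2) ?nnegrE // frobenius_sqr mxinnerE real_normK ?num_real //.
rewrite (bigD1 i) //= (bigD1 j) //= -expr2 -addrA lerDl addr_ge0 //.
  by apply: sumr_ge0 => k _; rewrite -expr2 sqr_ge0.
by do 2![apply: sumr_ge0 => ? _]; rewrite -expr2 sqr_ge0.
Qed.

Lemma frobenius0 m n : frobenius_norm (0 : 'M[R]_(m, n)) = 0.
Proof. by rewrite -[0 in LHS](scale0r (0 : 'M[R]_(m, n))) frobeniusZ normr0 mul0r. Qed.

Lemma frobenius_unit n (v : 'cV[R]_n) :
  mxinner v v = 1 -> frobenius_norm v = 1.
Proof.
by move=> v1; apply/eqP; rewrite -sqrp_eq1 ?frobenius_ge0 // frobenius_sqr v1.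
Qed.

Lemma frobenius_mulmx_unit m n (A : 'M[R]_(m, n)) (v : 'cV[R]_n) :
  mxinner v v = 1 -> frobenius_norm (A *m v) <= frobenius_norm A.
Proof.
by move=> v1; apply: (le_trans (frobeniusM _ _)); rewrite (frobenius_unit v1) mulr1.
Qed.

Lemma frobenius_scale_unit n s (v : 'cV[R]_n) :
  0 <= s -> mxinner v v = 1 -> frobenius_norm (s *: v) = s.
Proof. by move=> s0 v1; rewrite frobeniusZ (frobenius_unit v1) mulr1 ger0_norm. Qed.

End FrobeniusInnerProduct.
#[local] Hint Resolve frobenius_ge0 : core.

(** * The nuclear norm and singular value decompositions *)

Section NuclearNorm.
Variable R : realType.
Implicit Types m n : nat.

(** Each root of [p] is repeated as often as it occurs in [s]: the multiplicity
    of [x] in [p] is its number of occurrences. *)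
Lemma sum_singular_values_of_roots (s : seq R) (p : {poly R}) :
  p = \prod_(x <- s) ('X - x%:P) ->
  \sum_(t <- flatten [seq nseq (mup x p) (Num.sqrt x) | x <- rootsR p]) t
    = \sum_(x <- s) Num.sqrt x.
Proof.
move=> pE; rewrite big_flatten big_map /=.
have p0 : p != 0 by rewrite pE monic_neq0 // monic_prod_XsubC.
have us : perm_eq (undup s) (rootsR p).
  apply: uniq_perm; rewrite ?undup_uniq //; first exact: uniq_roots.
  by move=> x; rewrite mem_undup -(roots_on_rootsR p0) in_itv /= pE root_prod_XsubC.
rewrite -(perm_big _ us) /= -[RHS]big_undup_iterop_count /=.
apply: eq_bigr => x _.
by rewrite big_nseq pE mu_prod_XsubC Monoid.iteropE.
Qed.

Lemma char_poly_orthogonal_conj n (A V : 'M[R]_n) :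
  V^T *m V = 1%:M -> char_poly (V *m A *m V^T) = char_poly A.
Proof.
move=> VV; have VV' : V *m V^T = 1%:M by apply: mulmx1C.
rewrite /char_poly; have -> : char_poly_mx (V *m A *m V^T)
    = map_mx polyC V *m char_poly_mx A *m map_mx polyC V^T.
  rewrite /char_poly_mx mulmxBr mulmxBl !map_mxM; congr (_ - _).
  by rewrite mul_mx_scalar -scalemxAl -map_mxM VV' map_mx1 scalemx1.
rewrite !det_mulmx mulrAC -det_mulmx -map_mxM VV' map_mx1.
by rewrite det1 mul1r.
Qed.

(** Conjugating by [V] does not change the characteristic polynomial of
    [A^T A], whose roots can then be read off the diagonal. *)
Lemma nuclear_norm_diagonalized m n (A : 'M[R]_(m, n)) (V : 'M[R]_n)
    (d : 'rV[R]_n) :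
  V^T *m V = 1%:M -> V^T *m (A^T *m A) *m V = diag_mx d ->
  nuclear_norm A = \sum_j Num.sqrt (d 0 j).
Proof.
move=> VV dE; have VV' : V *m V^T = 1%:M by apply: mulmx1C.
have pE : char_poly (A^T *m A) = \prod_(x <- [seq d 0 j | j <- enum 'I_n]) ('X - x%:P).
  rewrite -(@char_poly_orthogonal_conj _ _ V^T) ?trmxK // dE.
  rewrite char_poly_trig ?diag_mx_is_trig // big_map big_enum /=.
  by apply: eq_bigr => j _; rewrite mxE eqxx mulr1n.
by rewrite /nuclear_norm (sum_singular_values_of_roots pE) big_map big_enum.
Qed.

(** In a column of a rectangular diagonal matrix at most the entry of index [c]
    survives; it may be absent, when [c] is not below [m]. *)
Lemma sqrt_sum_sqr_single m (f : 'I_m -> R) (c : nat) :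
  (forall i : 'I_m, (i != c :> nat) -> f i = 0) -> (forall i, 0 <= f i) ->
  Num.sqrt (\sum_i f i ^+ 2) = \sum_i f i.
Proof.
move=> f0 fp; have [cm|cm] := ltnP c m.
  have z i : i != Ordinal cm -> f i = 0 by move=> ic; apply: f0.
  rewrite (bigD1 (Ordinal cm)) //= [in RHS](bigD1 (Ordinal cm)) //=.
  rewrite !big1 ?addr0 ?sqrtr_sqr ?ger0_norm // => i /z -> //.
  by rewrite expr0n.
have z i : f i = 0.
  by apply: f0; rewrite neq_ltn (leq_trans (ltn_ord i) cm).
by rewrite !big1 ?sqrtr0 // => i _; rewrite z ?expr0n.
Qed.

Lemma rect_diag_gram m n (S : 'M[R]_(m, n)) :
  (forall (i : 'I_m) (j : 'I_n), (i != j :> nat) -> S i j = 0) ->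
  S^T *m S = diag_mx (\row_j \sum_i S i j ^+ 2).
Proof.
move=> S0; apply/matrixP => j k; rewrite !mxE.
have [<-|jk] := eqVneq j k.
  by rewrite mulr1n; apply: eq_bigr => i _; rewrite mxE expr2.
rewrite mulr0n big1 // => i _; rewrite mxE.
have [ij|ij] := eqVneq (i : nat) j; last by rewrite S0 // mul0r.
by rewrite (S0 i k) ?mulr0 // ij; apply: contra_neq jk => /val_inj.
Qed.

Lemma svd_gram m n (A : 'M[R]_(m, n)) U S V : is_svd A U S V ->
  V^T *m (A^T *m A) *m V = diag_mx (\row_j \sum_i S i j ^+ 2).
Proof.
move=> [UU VV S0 _ ->]; rewrite -rect_diag_gram // !trmx_mul trmxK.
by rewrite -!mulmxA VV mulmx1 (mulmxA U^T) UU mul1mx (mulmxA V^T) VV mul1mx.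
Qed.

Lemma nuclear_norm_svd m n (A : 'M[R]_(m, n)) U S V : is_svd A U S V ->
  nuclear_norm A = \sum_i \sum_j S i j.
Proof.
move=> sv; have [_ VV S0 Sp _] := sv.
rewrite (nuclear_norm_diagonalized VV (svd_gram sv)) exchange_big /=.
apply: eq_bigr => j _; rewrite mxE (sqrt_sum_sqr_single (c := j)) // => i; exact: S0.
Qed.

End NuclearNorm.

(** * Limits of matrices and continuity of the nuclear norm *)

Section MatrixLimits.
Variable R : realType.
Variables (T : Type) (F : set_system T).
Context {FF : ProperFilter F}.
Implicit Types m n p : nat.

Lemma mx_cvgP m n (A : T -> 'M[R]_(m, n)) (L : 'M[R]_(m, n)) :
  A t @[t --> F] --> L <-> forall i j, A t i j @[t --> F] --> L i j.
Proof.
split=> [AL i j|AL].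
  have c := @coord_continuous R m n i j L.
  exact: (cvg_comp _ _ AL c).
apply/cvg_ballP => e e0.
suff : \forall t \near F, forall i j, ball (L i j) e (A t i j).
  by apply: filterS => t H; split.
apply: filter_forall => i; apply: filter_forall => j.
by have /cvg_ballP := AL i j; apply.
Qed.

Lemma cvg_bigsum (I : finType) (f : I -> T -> R) (l : I -> R) :
  (forall i, f i t @[t --> F] --> l i) ->
  \sum_i f i t @[t --> F] --> \sum_i l i.
Proof. by move=> H; apply: cvg_big => // -[x y]; exact: add_continuous. Qed.

Lemma cvg_mulmx m n p (A : T -> 'M[R]_(m, n)) (B : T -> 'M[R]_(n, p))
    (L : 'M[R]_(m, n)) (M : 'M[R]_(n, p)) :
  A t @[t --> F] --> L -> B t @[t --> F] --> M ->
  A t *m B t @[t --> F] --> L *m M.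
Proof.
move=> /mx_cvgP AL /mx_cvgP BM; apply/mx_cvgP => i j; rewrite mxE.
under eq_fun do rewrite mxE.
by apply: cvg_bigsum => k; apply: cvgM.
Qed.

Lemma cvg_trmx m n (A : T -> 'M[R]_(m, n)) (L : 'M[R]_(m, n)) :
  A t @[t --> F] --> L -> (A t)^T @[t --> F] --> L^T.
Proof.
move=> /mx_cvgP AL; apply/mx_cvgP => i j; rewrite mxE.
under eq_fun do rewrite mxE.
exact: AL.
Qed.

Lemma cvg_mxinner m n (A B : T -> 'M[R]_(m, n)) (L M : 'M[R]_(m, n)) :
  A t @[t --> F] --> L -> B t @[t --> F] --> M ->
  mxinner (A t) (B t) @[t --> F] --> mxinner L M.
Proof.
move=> /mx_cvgP AL /mx_cvgP BM; rewrite mxinnerE.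
under eq_fun do rewrite mxinnerE.
by do 2![apply: cvg_bigsum => ?]; apply: cvgM.
Qed.

Lemma mx_cvg_unique m n (A : T -> 'M[R]_(m, n)) (L M : 'M[R]_(m, n)) :
  A t @[t --> F] --> L -> A t @[t --> F] --> M -> L = M.
Proof.
move=> /mx_cvgP AL /mx_cvgP AM; apply/matrixP => i j.
exact: (cvg_unique (@norm_hausdorff _ R^o) (AL i j) (AM i j)).
Qed.

End MatrixLimits.

Section Ultrafilters.

(** An ultrafilter contains the preimage of each set or that of its complement. *)
Lemma fmap_ultra (T U : Type) (f : T -> U) (F : set_system T) :
  UltraFilter F -> UltraFilter (fmap f F).
Proof.
move=> FU; split=> [|G PG FG]; first exact: fmap_proper_filter.
rewrite eqEsubset; split=> // A GA.
have [//|FA] := in_ultra_setVsetC (f @^-1` A) FU.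
have GnA : G (~` A) by exact: FG.
have : G (A `&` ~` A) by exact: filterI.
rewrite setICr.
by move=> G0; case: (@filter_not_empty _ _ PG G0).
Qed.

(** If [f] did not tend to [l], some neighbourhood of [l] would be avoided on a
    set compatible with [F], hence along an ultrafilter refining [F]. *)
Lemma cvg_from_ultrafilters (T : Type) (U : topologicalType) (f : T -> U)
    (F : set_system T) (l : U) : ProperFilter F ->
  (forall G, UltraFilter G -> F `<=` G -> f t @[t --> G] --> l) ->
  f t @[t --> F] --> l.
Proof.
move=> PF H A nA; apply: contrapT => FA.
have PW : ProperFilter (within (~` (f @^-1` A)) F).
  apply: Build_ProperFilter_ex => B; rewrite /within /= => WB.
  apply: contrapT => B0; apply: FA.
  apply: (filterS _ WB) => t Bt; apply: contrapT => At.
  by apply: B0; exists t; exact: Bt.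
have [G [GU WG]] := ultraFilterLemma PW.
have GF : F `<=` G by move=> B FB; apply/WG; apply: (filterS _ FB) => t Bt _.
have GA : G (~` (f @^-1` A)) by apply: WG; exact: withinT.
have GA' : G (f @^-1` A) by exact: H.
have : G (f @^-1` A `&` ~` (f @^-1` A)) by exact: filterI.
rewrite setICr.
by move=> G0; case: (@filter_not_empty _ _ ultra_proper G0).
Qed.

Lemma ultra_bounded_cvg (R : realType) (T : Type) (G : set_system T)
    (f : T -> R) (M : R) : UltraFilter G -> (forall t, `|f t| <= M) ->
  exists l : R, f t @[t --> G] --> l.
Proof.
move=> GU fM.
have : compact `[- M, M] by exact: segment_compact.
rewrite compact_ultra => /(_ (fmap f G) (fmap_ultra f GU)).
case.
  change (G (f @^-1` `[- M, M])); apply: filterE => t.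
  by rewrite /= in_itv /= -ler_norml; exact: fM.
by move=> l [_ fl]; exists l.
Qed.

End Ultrafilters.

Section NuclearNormContinuity.
Variable R : realType.
Implicit Types m n : nat.

Lemma orthogonal_entry_le n (V : 'M[R]_n) i j :
  V^T *m V = 1%:M -> `|V i j| <= 1.
Proof.
move=> VV; have h : mxinner (col j V) (col j V) = 1.
  have <- : (V^T *m V) j j = 1 by rewrite VV mxE eqxx.
  by rewrite mxinnerE mxE; apply: eq_bigr => k _; rewrite big_ord1 !mxE.
have -> : 1 = frobenius_norm (col j V).
  by apply/eqP; rewrite eq_sym -sqrp_eq1 ?frobenius_ge0 // frobenius_sqr h.
by have := entry_le_frobenius (col j V) i 0; rewrite mxE.
Qed.

(** The right singular factors are orthogonal, hence bounded: along an
    ultrafilter they converge, and their limit diagonalizes [L^T L]. *)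
Lemma nuclear_norm_cvg m n (A : nat -> 'M[R]_(m, n)) (L : 'M[R]_(m, n)) :
  (forall k, exists U S V, is_svd (A k) U S V) ->
  A k @[k --> \oo] --> L ->
  nuclear_norm (A k) @[k --> \oo] --> nuclear_norm L.
Proof.
move=> svdA AL.
have : forall k, exists V : 'M[R]_n, exists d : 'rV[R]_n,
    V^T *m V = 1%:M /\ V^T *m ((A k)^T *m A k) *m V = diag_mx d.
  move=> k; have [U [S [V sv]]] := svdA k; exists V.
  exists (\row_j \sum_i S i j ^+ 2); split; last exact: (svd_gram sv).
  by case: sv.
move=> /choice [V /choice [d Vd]].
apply: cvg_from_ultrafilters => G GU GF.
have AG : A k @[k --> G] --> L by move=> B /AL; exact: GF.
have : forall i, exists f : 'I_n -> R, forall j, V k i j @[k --> G] --> f j.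
  move=> i; have : forall j, exists l : R, V k i j @[k --> G] --> l.
    move=> j.
      apply: (@ultra_bounded_cvg _ _ _ _ 1) => k.
      by apply: orthogonal_entry_le; case: (Vd k).
  by move=> /choice [f Hf]; exists f.
move=> /choice [f Hf]; pose V0 : 'M[R]_n := \matrix_(i, j) f i j.
have VV0 : V k @[k --> G] --> V0 by apply/mx_cvgP => i j; rewrite mxE.
have V01 : V0^T *m V0 = 1%:M.
  have h : (V k)^T *m V k @[k --> G] --> V0^T *m V0.
    by apply: cvg_mulmx => //; apply: cvg_trmx.
  apply: (mx_cvg_unique h).
  rewrite (_ : (fun k => _) = fun=> 1%:M); first exact: cvg_cst.
  by apply/funext => k; case: (Vd k).
pose d0 : 'rV[R]_n := \row_j (V0^T *m (L^T *m L) *m V0) j j.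
have dE k j : d k 0 j = ((V k)^T *m ((A k)^T *m A k) *m V k) j j.
  by case: (Vd k) => _ ->; rewrite mxE eqxx mulr1n.
have cv : (V k)^T *m ((A k)^T *m A k) *m V k @[k --> G] --> V0^T *m (L^T *m L) *m V0.
  by do !(apply: cvg_mulmx || apply: cvg_trmx).
have V0d : V0^T *m (L^T *m L) *m V0 = diag_mx d0.
  apply/matrixP => i j; rewrite [RHS]mxE; have [<-|ij] := eqVneq i j.
    by rewrite [in RHS]mxE ?eqxx mulr1n.
  rewrite mulr0n; have /mx_cvgP/(_ i j) cij := cv.
  apply: (cvg_unique (@norm_hausdorff _ R^o) cij).
  rewrite (_ : (fun k => _) = fun=> 0); first exact: cvg_cst.
  by apply/funext => k; case: (Vd k) => _ ->; rewrite mxE (negbTE ij) mulr0n.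
rewrite (nuclear_norm_diagonalized V01 V0d).
rewrite (_ : (fun k => _) = fun k => \sum_j Num.sqrt (d k 0 j)); last first.
  by apply/funext => k; case: (Vd k) => V1 V2; rewrite (nuclear_norm_diagonalized V1 V2).
apply: cvg_bigsum => j.
apply: continuous_cvg; first exact: sqrt_continuous.
rewrite mxE; under eq_fun do rewrite dE.
by have /mx_cvgP := cv; apply.
Qed.

End NuclearNormContinuity.

(** * Duality and curvature of the nuclear norm *)

Section NuclearDuality.
Variable R : realType.
Implicit Types m n : nat.

(** [-Y] has operator norm at most [tau].  By scaling [a] against [b] this
    bilinear form is equivalent to [- a^T Y b <= tau |a| |b|], but it passes to
    limits and to diagonal matrices without square roots. *)
Definition dual_ball m n (tau : R) (Y : 'M[R]_(m, n)) : Prop :=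
  forall (a : 'cV[R]_m) (b : 'cV[R]_n),
    - mxinner a (Y *m b) <= tau / 2 * (mxinner a a + mxinner b b).

(** [-Y] norms [D]: it sends each right singular vector of [D] to [tau] times
    the matching left one.  Indexing by pairs of row and column indices lets a
    rectangular [D] be treated without choosing which dimension is smaller;
    only the pairs with a nonzero [s p] carry information. *)
Definition nuclear_dual_pair m n (tau : R) (Y D : 'M[R]_(m, n)) : Prop :=
  exists (s : 'I_m * 'I_n -> R) (u : 'I_m * 'I_n -> 'cV[R]_m)
         (v : 'I_m * 'I_n -> 'cV[R]_n),
  [/\ forall p, 0 <= s p,
      forall p, mxinner (u p) (u p) = 1 /\ mxinner (v p) (v p) = 1,
      forall p, s p != 0 ->
        [/\ Y *m v p = - tau *: u p, Y^T *m u p = - tau *: v p,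
            D *m v p = s p *: u p & D^T *m u p = s p *: v p],
      D = \sum_p s p *: (u p *m (v p)^T)
    & nuclear_norm D = \sum_p s p].

Lemma mxinner_outer m n (Z : 'M[R]_(m, n)) (u : 'cV[R]_m) (v : 'cV[R]_n) :
  mxinner Z (u *m v^T) = mxinner u (Z *m v).
Proof. by rewrite mxinnerC mxinnerMr trmxK. Qed.

Lemma mxinner_mulmx_adj m n (A : 'M[R]_(m, n)) (x : 'cV[R]_m) (y : 'cV[R]_n) :
  mxinner x (A *m y) = mxinner (A^T *m x) y.
Proof. by rewrite mxinnerMl trmxK. Qed.

Lemma mxinner_cV_outer m n (x a : 'cV[R]_m) (b y : 'cV[R]_n) :
  mxinner x (a *m b^T *m y) = mxinner x a * mxinner b y.
Proof.
rewrite -mulmxA [b^T *m y]mx11_scalar mul_mx_scalar mxinnerZr mulrC.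
by congr (_ * _); rewrite /mxinner /mxtrace big_ord1.
Qed.

Lemma nuclear_dual_le m n tau (Y D Z : 'M[R]_(m, n)) :
  nuclear_dual_pair tau Y D -> dual_ball tau Z ->
  - mxinner Z D <= tau * nuclear_norm D.
Proof.
move=> [s [u [v [s0 uv _ DE ->]]]] Zb.
rewrite {1}DE mxinner_sumr -sumrN mulr_sumr; apply: ler_sum => p _.
rewrite mxinnerZr mxinner_outer -mulrN mulrC ler_wpM2r //.
have [u1 v1] := uv p; have := Zb (u p) (v p); rewrite u1 v1; lra.
Qed.

Lemma nuclear_dual_eq m n tau (Y D : 'M[R]_(m, n)) :
  nuclear_dual_pair tau Y D -> tau * nuclear_norm D = - mxinner Y D.
Proof.
move=> [s [u [v [s0 uv sY DE ->]]]].
rewrite [in RHS]DE mxinner_sumr -sumrN mulr_sumr; apply: eq_bigr => p _.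
rewrite mxinnerZr mxinner_outer.
have [->|/sY [-> _ _ _]] := eqVneq (s p) 0; first by rewrite mulr0 mul0r oppr0.
have [u1 _] := uv p; rewrite mxinnerZr u1; ring.
Qed.

(** Let [S (a, b) = (tau a + Y b, tau b + Y^T a)] be the slack operator on pairs
    of vectors, which is positive semidefinite when [Y] is in the dual ball and
    vanishes on the pairs normed by [-Y], and [T (a, b) = (D b, D^T a)] the
    symmetric dilation of [D].  This is [<S (a, b), S (T (a, b))>]. *)
Definition slack_dilation m n tau (Y D : 'M[R]_(m, n)) (a : 'cV[R]_m)
    (b : 'cV[R]_n) : R :=
  let p := tau *: a + Y *m b in let q := tau *: b + Y^T *m a in
  mxinner p (tau *: (D *m b) + Y *m (D^T *m a))
  + mxinner q (tau *: (D^T *m a) + Y^T *m (D *m b)).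

(** [S] and [T] commute and [S] kills the eigenvectors [(u, v)] of [T] with
    positive eigenvalue; the remaining [(u, - v)] have a negative eigenvalue.
    So [S^2 T] is negative semidefinite.  In this form the fact survives in the
    limit, where no singular value decomposition is at hand. *)
Lemma nuclear_dual_slack_dilation_le0 m n tau (Y D : 'M[R]_(m, n)) a b :
  nuclear_dual_pair tau Y D -> slack_dilation tau Y D a b <= 0.
Proof.
move=> [s [u [v [s0 uv sY DE _]]]]; rewrite /slack_dilation.
set p := _ + Y *m b; set q := _ + Y^T *m a.
have DB x y : mxinner x (D *m y) = \sum_i s i * (mxinner x (u i) * mxinner (v i) y).
  rewrite DE mulmx_suml mxinner_sumr; apply: eq_bigr => i _.
  by rewrite -scalemxAl mxinnerZr mxinner_cV_outer.
have DT x y : mxinner x (D^T *m y) = mxinner y (D *m x).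
  by rewrite mxinnerC mxinnerMl trmxK.
rewrite !mxinnerDr !mxinnerZr (mxinner_mulmx_adj Y p) (mxinner_mulmx_adj Y^T q) trmxK.
rewrite !DT !DB !mulr_sumr -!big_split /=; apply: sumr_le0 => i _.
have [->|si] := eqVneq (s i) 0; first by rewrite !mul0r !mulr0 !addr0.
have [Yv Yu _ _] := sY i si.
have pu : mxinner p (u i) = tau * (mxinner a (u i) - mxinner (v i) b).
  rewrite mxinnerDl mxinnerZl mxinnerMl Yu mxinnerZr (mxinnerC b); ring.
have qv : mxinner (v i) q = - (tau * (mxinner a (u i) - mxinner (v i) b)).
  by rewrite mxinnerC mxinnerDl mxinnerZl mxinnerMl trmxK Yv mxinnerZr (mxinnerC b); ring.
have Yp : mxinner (v i) (Y^T *m p) = - tau * mxinner p (u i).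
  by rewrite mxinner_mulmx_adj trmxK Yv mxinnerZl mxinnerC.
have Yq : mxinner (Y *m q) (u i) = - tau * mxinner (v i) q.
  by rewrite mxinnerMl Yu mxinnerZr mxinnerC.
rewrite Yp Yq pu qv.
set al := mxinner a (u i); set be := mxinner (v i) b.
rewrite [X in X <= 0](_ : _ = - (2 * s i * (tau * (al - be)) ^+ 2)); last by ring.
by rewrite oppr_le0 mulr_ge0 ?sqr_ge0 // mulr_ge0.
Qed.

(** The nonzero spectrum of [H] is bounded away from 0.  A generalized inverse
    [P], with [H P H = H], replaces diagonalization:
    [<w, H w> = <H w, P (H w)>]. *)
Lemma sym_quadratic_gap N (H : 'M[R]_N) : H^T = H ->
  exists2 K : R, 0 <= K &
    forall w : 'cV[R]_N, mxinner w (H *m w) <= K * frobenius_norm (H *m w) ^+ 2.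
Proof.
move=> HT; have HP : H *m pinvmx H *m H = H by exact: mulmxKpV.
move: (pinvmx H) HP => P HP; exists (frobenius_norm P); first exact: frobenius_ge0.
move=> w; have {1}-> : H *m w = H *m (P *m (H *m w)) by rewrite !mulmxA HP.
rewrite mxinner_mulmx_adj HT (le_trans (mxinner_le_frobenius _ _)) //.
rewrite expr2 mulrA [leRHS]mulrAC [leLHS]mulrC.
by rewrite ler_wpM2r ?frobenius_ge0 // frobeniusM.
Qed.

(** The nonzero singular values of [A] are bounded away from 0. *)
Lemma kernel_gap m n (A : 'M[R]_(m, n)) :
  exists2 k : R, 0 < k & forall v : 'cV[R]_n,
    frobenius_norm (A *m v) <= k * frobenius_norm (A^T *m (A *m v)).
Proof.
have [|K K0 HK] := @sym_quadratic_gap _ (A^T *m A); first by rewrite trmx_mul trmxK.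
exists (K + 1) => [|v]; first by rewrite ltr_wpDl.
have := HK v; rewrite -mulmxA -mxinnerMl -frobenius_sqr => h.
set x := frobenius_norm (A *m v) in h *.
set y := frobenius_norm (A^T *m (A *m v)) in h *.
have x0 : 0 <= x by exact: frobenius_ge0.
have y0 : 0 <= y by exact: frobenius_ge0.
rewrite -(@ler_pXn2r _ 2) ?nnegrE // ?mulr_ge0 ?addr_ge0 //.
apply: (le_trans h); rewrite exprMn ler_wpM2r ?sqr_ge0 //; nra.
Qed.

(** The gap of the slack operator, written as a symmetric block matrix. *)
Lemma slack_gap m n tau (Y : 'M[R]_(m, n)) :
  exists2 K : R, 0 <= K & forall (u : 'cV[R]_m) (v : 'cV[R]_n),
    let p := tau *: u + Y *m v in let q := tau *: v + Y^T *m u in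
    mxinner u p + mxinner v q
      <= K * (frobenius_norm p ^+ 2 + frobenius_norm q ^+ 2).
Proof.
pose H := block_mx tau%:M Y Y^T tau%:M.
have [|K K0 HK] := @sym_quadratic_gap _ H.
  by rewrite /H tr_block_mx !tr_scalar_mx trmxK.
exists K => // u v; cbv zeta.
set p := tau *: u + _; set q := tau *: v + _; have := HK (col_mx u v).
rewrite /H mul_block_col !mul_scalar_mx !frobenius_sqr.
rewrite [Y^T *m u + _]addrC -/p -/q.
have E (x x' : 'cV[R]_m) (y y' : 'cV[R]_n) :
    mxinner (col_mx x y) (col_mx x' y') = mxinner x x' + mxinner y y'.
  by rewrite /mxinner tr_col_mx mul_row_col mxtraceD.
by rewrite !E.
Qed.



(** Singular values are 1-Lipschitz: those of [D] are close either to 0 or to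
    one of the nonzero singular values of [D0], which stay above a gap.  The gap
    is used in the form of [kernel_gap], with no matching of singular values. *)
Lemma singular_value_dichotomy m n (M : R) (D0 : 'M[R]_(m, n)) : 0 <= M ->
  exists c g : R, [/\ 0 <= c, 0 < g &
    forall (D : 'M[R]_(m, n)) (s : R) (u : 'cV[R]_m) (v : 'cV[R]_n),
      frobenius_norm D <= M -> 0 <= s -> mxinner u u = 1 -> mxinner v v = 1 ->
      D *m v = s *: u -> D^T *m u = s *: v ->
      s <= c * frobenius_norm (D - D0) \/ g <= s].
Proof.
move=> M0; have [k k0 gap] := kernel_gap D0.
set F0 := frobenius_norm D0; have F00 : 0 <= F0 by exact: frobenius_ge0.
exists (2 * (1 + k * M + k * F0)), (2 * k)^-1; split.
- have k0' := ltW k0; by rewrite !(mulr_ge0, addr_ge0).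
- by rewrite invr_gt0 mulr_gt0.
move=> D s u v DM s0 u1 v1 Dv Du; set e := frobenius_norm (D - D0).
have e0 : 0 <= e by exact: frobenius_ge0.
have sM : s <= M.
  by rewrite -(frobenius_scale_unit s0 u1) -Dv (le_trans (frobenius_mulmx_unit D v1)).
have lo : s - e <= frobenius_norm (D0 *m v).
  have h := frobenius_triangle (D0 *m v) (D *m v) 0.
  move: h; rewrite !subr0 -mulmxBl {1}Dv (frobenius_scale_unit s0 u1).
  have := frobenius_mulmx_unit (D - D0) v1; rewrite -/e; lra.
have hi : frobenius_norm (D0^T *m (D0 *m v)) <= s ^+ 2 + s * e + F0 * e.
  have -> : D0^T *m (D0 *m v)
      = (s ^+ 2) *: v - s *: ((D - D0)^T *m u) - D0^T *m ((D - D0) *m v).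
    rewrite mulmxBl mulmxBr Dv linearB /= mulmxBl Du.
    rewrite -scalemxAr scalerBr scalerA -expr2.
    by rewrite !subKr.
  apply: (le_trans (frobeniusB _ _)).
  apply: lerD; first apply: (le_trans (frobeniusB _ _)).
    apply: lerD; first by rewrite frobenius_scale_unit ?sqr_ge0.
    rewrite frobeniusZ ger0_norm // ler_wpM2l // -[e]frobeniusT.
    exact: frobenius_mulmx_unit.
  apply: (le_trans (frobeniusM _ _)); rewrite frobeniusT ler_wpM2l //.
  exact: frobenius_mulmx_unit.
have [|sg] := leP (2 * k)^-1 s; first by right.
left; have {}sg : 2 * k * s <= 1.
  by rewrite -ler_pdivlMl ?mulr_gt0 // mulr1 ltW.
have : s - e <= k * (s ^+ 2 + s * e + F0 * e).
  by apply: (le_trans lo); apply: (le_trans (gap v)); rewrite ler_pM2l.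
have : k * (s * e) <= k * M * e by rewrite -mulrA ler_pM2l // ler_wpM2r.
have : 2 * k * s * s <= s by rewrite ler_piMl.
rewrite expr2; lra.
Qed.

(** The left-hand side measures by how much [-Z] fails to norm [D]; when [-Z]
    norms [D0], Cauchy-Schwarz alone gives [|Z - Y| |D - D0|], and the gain of
    one order over this is what makes the contraction quadratic.
    The defect is the sum over singular triples of [s <w, S w> / 2], with
    [w = (u, v)] and [S] the slack operator of [Z].  By [slack_gap],
    [<w, S w> <= K |S w|^2], and [S w] is small for two reasons: it is
    [O(|Z - Y|)] because the slack operator of [Y] kills [w], and [s |S w|] is
    [O(|D - D0|)] because [<S w, S (T0 w)> <= 0] for the dilation [T0] of [D0],
    while the dilation of [D] multiplies [w] by [s].  The first reason is used
    when [s = O(|D - D0|)], the second one when [s] is bounded below. *)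
Lemma nuclear_curvature m n tau M (Z D0 : 'M[R]_(m, n)) : 0 < tau -> 0 <= M ->
  (forall a b, slack_dilation tau Z D0 a b <= 0) ->
  exists2 K : R, 0 <= K & forall Y D : 'M[R]_(m, n),
    nuclear_dual_pair tau Y D -> frobenius_norm D <= M ->
    tau * nuclear_norm D + mxinner Z D
      <= K * (frobenius_norm (Z - Y) ^+ 2 * frobenius_norm (D - D0)
              + frobenius_norm (D - D0) ^+ 2).
Proof.
move=> tau0 M0 anti; have [K K0 HK] := slack_gap tau Z.
have [c [g [c0 g0 dich]]] := singular_value_dichotomy D0 M0.
set T := tau + frobenius_norm Z.
have T0 : 0 <= T by rewrite addr_ge0 ?frobenius_ge0 // ltW.
set L := K * (c + 2 * T ^+ 2 / g).
have L0 : 0 <= L by rewrite mulr_ge0 // addr_ge0 // divr_ge0 ?mulr_ge0 ?sqr_ge0 // ltW.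
exists (\sum_(p : 'I_m * 'I_n) L); first exact: sumr_ge0.
move=> Y D [s [u [v [s0 uv sY DE ->]]]] DM.
rewrite {1}DE mxinner_sumr mulr_sumr -big_split /= mulr_suml; apply: ler_sum => i _.
set e := frobenius_norm (Z - Y); set d := frobenius_norm (D - D0).
have e0 : 0 <= e by exact: frobenius_ge0.
have d0 : 0 <= d by exact: frobenius_ge0.
rewrite mxinnerZr mxinner_outer.
have [->|si] := eqVneq (s i) 0.
  by rewrite mulr0 mul0r addr0 mulr_ge0 // addr_ge0 ?mulr_ge0 ?sqr_ge0.
have [[u1 v1] [Yv Yu Dv Du]] := (uv i, sY i si).
have {}s0 := s0 i; move: (s i) (u i) (v i) s0 si u1 v1 Yv Yu Dv Du.
move=> {DE sY uv u v}{}s u v s0 _ u1 v1 Yv Yu Dv Du.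
set p := tau *: u + Z *m v; set q := tau *: v + Z^T *m u.
set x := frobenius_norm p; set y := frobenius_norm q.
have x0 : 0 <= x by exact: frobenius_ge0.
have y0 : 0 <= y by exact: frobenius_ge0.
have xe : x <= e.
  have -> : x = frobenius_norm ((Z - Y) *m v).
    by rewrite mulmxBl Yv scaleNr opprK addrC.
  exact: frobenius_mulmx_unit.
have ye : y <= e.
  have -> : y = frobenius_norm ((Z - Y)^T *m u).
    by rewrite linearB /= mulmxBl Yu scaleNr opprK addrC.
  by rewrite /e -(frobeniusT (Z - Y)); exact: frobenius_mulmx_unit.
have quad : 2 * (tau + mxinner u (Z *m v)) <= K * (x ^+ 2 + y ^+ 2).
  apply: le_trans (HK u v); rewrite !mxinnerDr !mxinnerZr u1 v1.
  by rewrite (mxinner_mulmx_adj Z^T) trmxK (mxinnerC (Z *m v)); lra.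
(* [s |S w|^2 = <S w, S (T w)>], where [T] differs from [T0] by [O(d)] *)
have comm : s * (x ^+ 2 + y ^+ 2) <= (x + y) * (T * d).
  have sp : s *: p = tau *: (D *m v) + Z *m (D^T *m u).
    by rewrite Dv Du -scalemxAr scalerDr !scalerA mulrC.
  have sq : s *: q = tau *: (D^T *m u) + Z^T *m (D *m v).
    by rewrite Dv Du -scalemxAr scalerDr !scalerA mulrC.
  have split_ := anti u v; rewrite /slack_dilation -/p -/q in split_.
  have xx : s * x ^+ 2 = mxinner p (tau *: (D0 *m v) + Z *m (D0^T *m u))
      + mxinner p (tau *: ((D - D0) *m v) + Z *m ((D - D0)^T *m u)).
    rewrite frobenius_sqr -mxinnerZr sp -mxinnerDr; congr mxinner.
    rewrite linearB /= !mulmxBl mulmxBr scalerBr addrACA.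
    by rewrite ![_ + (_ - _)]addrC !subrK.
  have yy : s * y ^+ 2 = mxinner q (tau *: (D0^T *m u) + Z^T *m (D0 *m v))
      + mxinner q (tau *: ((D - D0)^T *m u) + Z^T *m ((D - D0) *m v)).
    rewrite frobenius_sqr -mxinnerZr sq -mxinnerDr; congr mxinner.
    rewrite linearB /= !mulmxBl mulmxBr scalerBr addrACA.
    by rewrite ![_ + (_ - _)]addrC !subrK.
  have r1 : mxinner p (tau *: ((D - D0) *m v) + Z *m ((D - D0)^T *m u)) <= x * (T * d).
    apply: (le_trans (mxinner_le_frobenius _ _)); rewrite ler_wpM2l //.
    apply: (le_trans (frobeniusD _ _)); rewrite mulrDl; apply: lerD.
      rewrite frobeniusZ gtr0_norm // ler_pM2l //; exact: frobenius_mulmx_unit.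
    apply: (le_trans (frobeniusM _ _)); rewrite ler_wpM2l ?frobenius_ge0 //.
    by rewrite /d -(frobeniusT (D - D0)); exact: frobenius_mulmx_unit.
  have r2 : mxinner q (tau *: ((D - D0)^T *m u) + Z^T *m ((D - D0) *m v)) <= y * (T * d).
    apply: (le_trans (mxinner_le_frobenius _ _)); rewrite ler_wpM2l //.
    apply: (le_trans (frobeniusD _ _)); rewrite mulrDl; apply: lerD.
      rewrite frobeniusZ gtr0_norm // ler_pM2l //.
      by rewrite /d -(frobeniusT (D - D0)); exact: frobenius_mulmx_unit.
    apply: (le_trans (frobeniusM _ _)); rewrite frobeniusT ler_wpM2l ?frobenius_ge0 //.
    exact: frobenius_mulmx_unit.
  rewrite mulrDr xx yy mulrDl; lra.
have K2 : tau * s + s * mxinner u (Z *m v) <= K / 2 * (s * (x ^+ 2 + y ^+ 2)).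
  have := ler_wpM2l s0 quad; lra.
apply: (le_trans K2); rewrite /L -!mulrA ler_wpM2l //.
have sqx : x ^+ 2 <= e ^+ 2 by rewrite ler_pXn2r ?nnegrE.
have sqy : y ^+ 2 <= e ^+ 2 by rewrite ler_pXn2r ?nnegrE.
have e2 := sqr_ge0 e; have d2 := sqr_ge0 d; have T2 := sqr_ge0 T.
have gi : 0 <= g^-1 by rewrite invr_ge0 ltW.
have [sc|sg] := dich D s u v DM s0 u1 v1 Dv Du.
  have : s * (x ^+ 2 + y ^+ 2) <= c * d * (2 * e ^+ 2).
    by apply: ler_pM => //; rewrite ?addr_ge0 ?sqr_ge0 //; lra.
  have t1 : 0 <= c * d ^+ 2 by rewrite mulr_ge0.
  have t2 : 0 <= T ^+ 2 / g * (e ^+ 2 * d + d ^+ 2).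
    by rewrite mulr_ge0 ?addr_ge0 ?mulr_ge0.
  lra.
have sxy : s * (x + y) <= 2 * T * d.
  have [xy0|xy0] := eqVneq (x + y) 0; first by rewrite xy0 mulr0 !mulr_ge0.
  have xyp : 0 < x + y by rewrite lt_neqAle eq_sym xy0 addr_ge0.
  rewrite -(ler_pM2l xyp).
  have : s * (x + y) ^+ 2 <= s * (2 * (x ^+ 2 + y ^+ 2)).
    rewrite ler_wpM2l //; have := sqr_ge0 (x - y); lra.
  lra.
have xyg : x + y <= 2 * T * d / g.
  rewrite ler_pdivlMr // mulrC; apply: le_trans sxy.
  by rewrite ler_wpM2r ?addr_ge0.
have : (x + y) * (T * d) <= 2 * T * d / g * (T * d) by rewrite ler_wpM2r ?mulr_ge0.
have t1 : 0 <= c * (e ^+ 2 * d + d ^+ 2) by rewrite mulr_ge0 ?addr_ge0 ?mulr_ge0.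
have t2 : 0 <= T ^+ 2 / g * (e ^+ 2 * d) by rewrite !mulr_ge0.
have t3 : 0 <= T ^+ 2 / g * d ^+ 2 by rewrite !mulr_ge0.
lra.
Qed.

End NuclearDuality.
(** * Singular value thresholding *)

Section SingularValueThresholding.
Variable R : realType.
Implicit Types m n : nat.

Lemma orthogonal_mxinner n (V : 'M[R]_n) (a : 'cV[R]_n) :
  V^T *m V = 1%:M -> mxinner (V^T *m a) (V^T *m a) = mxinner a a.
Proof. by move=> /mulmx1C VV; rewrite mxinnerMl trmxK mulmxA VV mul1mx. Qed.

Lemma orthogonal_col n (V : 'M[R]_n) j :
  V^T *m V = 1%:M -> mxinner (col j V) (col j V) = 1.
Proof.
move=> VV; have <- : (V^T *m V) j j = 1 by rewrite VV mxE eqxx.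
by rewrite mxinnerE mxE; apply: eq_bigr => k _; rewrite big_ord1 !mxE.
Qed.

Lemma rect_diag_mul_col m n (U : 'M[R]_m) (S : 'M[R]_(m, n)) (V : 'M[R]_n)
    (i : 'I_m) (j : 'I_n) :
  V^T *m V = 1%:M ->
  (forall (k : 'I_m) (l : 'I_n), (k != l :> nat) -> S k l = 0) ->
  (i = j :> nat) -> U *m S *m V^T *m col j V = S i j *: col i U.
Proof.
move=> VV S0 ij; rewrite [X in _ *m X]colE -mulmxA (mulmxA V^T) VV mul1mx -mulmxA.
have -> : S *m delta_mx j 0 = S i j *: delta_mx i 0 :> 'cV_m.
  apply/matrixP => k l; rewrite -colE !mxE ord1 eqxx andbT.
  have [->|ki] := eqVneq k i; first by rewrite mulr1.
  by rewrite mulr0 S0 // -ij; apply: contra_neq ki => /val_inj.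
by rewrite -scalemxAr -colE.
Qed.

Lemma mulmx_sum_outer m n (U : 'M[R]_m) (S : 'M[R]_(m, n)) (V : 'M[R]_n) :
  U *m S *m V^T = \sum_p S p.1 p.2 *: (col p.1 U *m (col p.2 V)^T).
Proof.
apply/matrixP => k l; rewrite summxE -(pair_bigA _ (fun i j =>
  (S i j *: (col i U *m (col j V)^T)) k l)) /= mxE exchange_big /=.
apply: eq_bigr => j _; rewrite !mxE mulr_suml; apply: eq_bigr => i _.
by rewrite !mxE big_ord1 !mxE; ring.
Qed.

Lemma sum_diag_le1 n (c : nat) : \sum_(j < n) ((c == j)%:R : R) <= 1.
Proof.
have [cn|cn] := ltnP c n.
  rewrite (bigD1 (Ordinal cn)) //= eqxx big1 ?addr0 // => j jc.
  by rewrite (_ : (c == j) = false) //; apply: contra_neqF jc => /eqP cj; apply: val_inj.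
rewrite big1 ?ler01 // => j _.
by rewrite (_ : (c == j) = false) //; apply: gtn_eqF; apply: leq_trans cn.
Qed.

(** The arithmetic-geometric inequality on each diagonal entry; every [x i] and
    every [y j] meets at most one of them. *)
Lemma rect_diag_form_le m n (S : 'M[R]_(m, n)) t (x : 'cV[R]_m) (y : 'cV[R]_n) :
  (forall (k : 'I_m) (l : 'I_n), (k != l :> nat) -> S k l = 0) ->
  (forall k l, 0 <= S k l <= t) -> 0 <= t ->
  mxinner x (S *m y) <= t / 2 * (mxinner x x + mxinner y y).
Proof.
move=> S0 St t0.
have -> : mxinner x (S *m y) = \sum_i \sum_j S i j * (x i 0 * y j 0).
  rewrite mxinnerE; apply: eq_bigr => i _; rewrite big_ord1 mxE mulr_sumr.
  by apply: eq_bigr => j _; ring.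
pose B : R := \sum_(i < m) \sum_(j < n) t / 2 *
    ((i == j :> nat)%:R * x i 0 ^+ 2 + (j == i :> nat)%:R * y j 0 ^+ 2).
apply: (@le_trans _ _ B); rewrite /B.
  apply: ler_sum => i _; apply: ler_sum => j _.
  have [ij|ij] := eqVneq (i : nat) (j : nat); last first.
    by rewrite S0 // !mul0r addr0 mulr0.
  rewrite !mul1r; have /andP[s0 st] := St i j.
  have h1 := sqr_ge0 (x i 0 - y j 0); have h2 := sqr_ge0 (x i 0 + y j 0).
  have a1 : 0 <= (t - S i j) * (x i 0 ^+ 2 + y j 0 ^+ 2).
    by rewrite mulr_ge0 ?subr_ge0 // addr_ge0 ?sqr_ge0.
  have a2 : 0 <= S i j * (x i 0 - y j 0) ^+ 2 by rewrite mulr_ge0.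
  lra.
under eq_bigr do rewrite -mulr_sumr.
rewrite -mulr_sumr ler_wpM2l ?divr_ge0 //.
under eq_bigr do rewrite big_split /=.
rewrite big_split /= !mxinnerE; apply: lerD.
  apply: ler_sum => i _; rewrite big_ord1 -expr2 -mulr_suml.
  by rewrite ler_piMl ?sqr_ge0 // sum_diag_le1.
rewrite exchange_big /=; apply: ler_sum => j _; rewrite big_ord1 -expr2 -mulr_suml.
by rewrite ler_piMl ?sqr_ge0 // sum_diag_le1.
Qed.

Lemma soft_threshold_spec (t x : R) : 0 <= t -> 0 <= x ->
  [/\ 0 <= soft_threshold t x, 0 <= x - soft_threshold t x <= t &
      soft_threshold t x != 0 -> x - soft_threshold t x = t].
Proof.
move=> t0 x0; rewrite /soft_threshold (ger0_norm x0).
have [->|xn] := eqVneq x 0; first by rewrite sgr0 mul0r subrr lexx t0 eqxx.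
have xp : 0 < x by rewrite lt_neqAle eq_sym xn.
rewrite gtr0_sg // mul1r maxEle.
case: ifP => h; first by rewrite subr0 x0 eqxx; split=> //; lra.
have {}h : 0 < x - t by rewrite ltNge h.
split; [exact: ltW | apply/andP; split; lra | by move=> _; ring].
Qed.

(** The Moreau decomposition of the proximal step: the part removed from [A] has
    singular values at most [tau / mu], with equality wherever the thresholded
    singular value is nonzero. *)
Lemma soft_threshold_dual m n (A D Y : 'M[R]_(m, n)) U S V (tau mu : R) :
  0 < tau -> 0 < mu -> is_svd A U S V ->
  D = U *m map_mx (soft_threshold (tau / mu)) S *m V^T ->
  Y = mu *: (D - A) ->
  [/\ nuclear_dual_pair tau Y D, dual_ball tau Y &
      is_svd D U (map_mx (soft_threshold (tau / mu)) S) V].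
Proof.
move=> tau0 mu0 [UU VV S0 Sp AE] DE YE.
set t := tau / mu in DE *; have t0 : 0 <= t by rewrite divr_ge0 // ltW.
set S' := map_mx _ _ in DE *; pose Th := S - S'.
have spec i j := soft_threshold_spec t0 (Sp i j).
have S'E i j : S' i j = soft_threshold t (S i j) by rewrite mxE.
have ThE i j : Th i j = S i j - soft_threshold t (S i j) by rewrite !mxE.
have S'0 (i : 'I_m) (j : 'I_n) : (i != j :> nat) -> S' i j = 0.
  by move=> ij; rewrite S'E S0 // /soft_threshold sgr0 mul0r.
have Th0 (i : 'I_m) (j : 'I_n) : (i != j :> nat) -> Th i j = 0.
  by move=> ij; rewrite ThE -S'E S'0 // S0 // subrr.
have YT : Y = - mu *: (U *m Th *m V^T).
  by rewrite YE DE AE /Th mulmxBr mulmxBl scaleNr -scalerN opprB.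
have svD : is_svd D U S' V.
  by split=> // i j; rewrite S'E; case: (spec i j).
split=> //.
- exists (fun p => S' p.1 p.2), (fun p => col p.1 U), (fun p => col p.2 V); split.
  + by move=> p; rewrite S'E; case: (spec p.1 p.2).
  + by move=> p; rewrite !orthogonal_col.
  + move=> [i j] /= sij.
    have ij : i = j :> nat by apply: contraNeq sij => ij; rewrite S'0.
    have Tij : Th i j = t by rewrite ThE; case: (spec i j) => _ _; apply; rewrite -S'E.
    have mt : mu * t = tau by rewrite /t mulrC divfK ?gt_eqF.
    have tr0 (M : 'M[R]_(m, n)) :
        (forall (i : 'I_m) (j : 'I_n), (i != j :> nat) -> M i j = 0) ->
        forall (k : 'I_n) (l : 'I_m), (k != l :> nat) -> M^T k l = 0.
      by move=> M0 k l kl; rewrite mxE M0 // eq_sym.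
    split.
    * by rewrite YT -scalemxAl (rect_diag_mul_col _ _ _ ij) // scalerA Tij mulNr mt.
    * rewrite YT linearZ /= !trmx_mul trmxK mulmxA -scalemxAl.
      rewrite (rect_diag_mul_col _ UU (tr0 _ Th0) (esym ij)).
      by rewrite [_^T j i]mxE scalerA Tij mulNr mt.
    * by rewrite DE (rect_diag_mul_col _ _ _ ij).
    * rewrite DE !trmx_mul trmxK mulmxA.
      by rewrite (rect_diag_mul_col _ UU (tr0 _ S'0) (esym ij)) [_^T j i]mxE.
  + by rewrite DE mulmx_sum_outer.
  + by rewrite (nuclear_norm_svd svD) pair_bigA.
- move=> a b; rewrite YT -scalemxAl mxinnerZr mulNr opprK -!mulmxA.
  rewrite mxinner_mulmx_adj.
  have := @rect_diag_form_le _ _ Th t (U^T *m a) (V^T *m b) Th0.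
  move=> /(_ _ t0); rewrite !orthogonal_mxinner // => h.
  have {}h : mxinner (U^T *m a) (Th *m (V^T *m b)) <= t / 2 * (mxinner a a + mxinner b b).
    by apply: h => k l; rewrite ThE; case: (spec k l).
  have <- : mu * t = tau by rewrite /t mulrC divfK ?gt_eqF.
  by have := ler_wpM2l (ltW mu0) h; rewrite !mulrA.
Qed.

End SingularValueThresholding.

(** * Sequences with geometric errors *)

Section GeometricErrors.
Variables (R : realType) (r : R) (del : nat -> R).
Hypotheses (r1 : 1 < r) (del0 : forall j, 0 < del j).
Hypothesis (delS : forall j, del j.+1 = del j / r).

Let kap := r / (r - 1).

Let kap_gt0 : 0 < kap.
Proof. by rewrite divr_gt0 ?subr_gt0 // (lt_trans ltr01). Qed.

Let kap_ge0 : 0 <= kap. Proof. exact: ltW. Qed.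
Let del_ge0 j : 0 <= del j. Proof. exact: ltW. Qed.
Let r_ge0 : 0 <= r. Proof. exact: ltW (lt_trans ltr01 r1). Qed.
Let r_gt0 : 0 < r. Proof. exact: lt_trans r1. Qed.
Hint Resolve kap_ge0 del_ge0 r_ge0 r_gt0 : core.

Let ckd_ge0 c j : 0 <= c -> 0 <= c * kap * del j.
Proof. by move=> c0; exact: mulr_ge0 (mulr_ge0 c0 kap_ge0) (del_ge0 j). Qed.

Let del_telescope j : del j = kap * (del j - del j.+1).
Proof.
rewrite delS /kap; field; rewrite subr_eq0 !gt_eqF // (lt_trans _ r1) //.
Qed.

Lemma geometric_step_le j : del j.+1 <= del j.
Proof.
by rewrite delS ler_pdivrMr ?(lt_trans _ r1) // ler_peMr // ltW.
Qed.

Lemma geometric_le j i : del (j + i)%N <= del j.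
Proof.
elim: i => [|i IH]; first by rewrite addn0.
by rewrite addnS (le_trans (geometric_step_le _)).
Qed.

Lemma geometric_cvg0 : del j @[j --> \oo] --> 0.
Proof.
have r0 : 0 < r by rewrite (lt_trans _ r1).
rewrite (_ : del = geometric (del 0%N) r^-1); last first.
  apply/funext; elim=> [|j IH]; first by rewrite /geometric /= expr0 mulr1.
  by rewrite delS IH /geometric /= exprSr mulrA.
by apply: cvg_geometric; rewrite gtr0_norm ?invr_gt0 // invf_lt1.
Qed.

(** Here [kap] sums the geometric series: [del j + del j.+1 + ... = kap * del j]. *)
Lemma geometric_almost_decr (u : nat -> R) c j : 0 <= c ->
  (forall i, (j <= i)%N -> u i.+1 <= u i + c * del i) ->
  forall i, u (j + i)%N <= u j + c * kap * del j.
Proof.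
move=> c0 H i.
suff : u (j + i)%N + c * kap * del (j + i)%N <= u j + c * kap * del j.
  by apply: le_trans; rewrite lerDl ckd_ge0.
elim: i => [|i IH]; first by rewrite addn0.
apply: le_trans IH; rewrite addnS.
have := H _ (leq_addr i j); rewrite {1}(del_telescope (j + i)); lra.
Qed.

Lemma geometric_limit_le (u : nat -> R) c j l : 0 <= c ->
  (forall i, (j <= i)%N -> u i.+1 <= u i + c * del i) ->
  u i @[i --> \oo] --> l -> l <= u j + c * kap * del j.
Proof.
move=> c0 H ul; apply: (ler_cvg_to ul (cvg_cst _)).
near=> i; have ji : (j <= i)%N by near: i; exact: nbhs_infty_ge.
by rewrite -(subnKC ji); exact: geometric_almost_decr.
Unshelve. all: by end_near. Qed.

(** [u i + c kap del i] is nonincreasing and nonnegative, so it converges; its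
    decrements bound [w]. *)
Lemma geometric_descent_cvg (u w : nat -> R) c : 0 <= c ->
  (forall i, 0 <= u i) -> (forall i, 0 <= w i) ->
  (forall i, u i.+1 + w i <= u i + c * del i) ->
  (exists l : R, 0 <= l /\ u i @[i --> \oo] --> l) /\ w i @[i --> \oo] --> 0.
Proof.
move=> c0 u0 w0 H.
pose v i := u i + c * kap * del i.
have vS i : v i.+1 + w i <= v i.
  rewrite /v; have := H i; rewrite {1}(del_telescope i); lra.
have vdecr : {homo v : i j / (i <= j)%N >-> j <= i}.
  apply/nonincreasing_seqP => i; have := vS i; have := w0 i; lra.
have v0 i : 0 <= v i by exact: addr_ge0 (u0 i) (ckd_ge0 i c0).
have vc : cvgn v.
  apply: nonincreasing_is_cvgn => //.
  by exists 0 => _ [i _ <-].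
have ck0 : c * kap * del i @[i --> \oo] --> 0.
  rewrite -(mulr0 (c * kap)); apply: cvgM; [exact: cvg_cst | exact: geometric_cvg0].
have vl : v i @[i --> \oo] --> limn v by exact: vc.
split.
  exists (limn v); split; first by apply: limr_ge => //; apply: nearW.
  have -> : u = (fun i => v i - c * kap * del i) by apply/funext => i; rewrite /v addrK.
  by rewrite -[limn v]subr0; apply: cvgB.
have z0 : v i - v i.+1 @[i --> \oo] --> 0.
  rewrite -(subrr (limn v)); apply: cvgB => //.
  by rewrite (@cvg_shiftS _ v).
apply: (squeeze_cvgr _ (cvg_cst 0) z0).
by apply: nearW => i; rewrite w0 /=; have := vS i; lra.
Qed.

(** A sequence tending to zero that contracts quadratically up to [del] is
    eventually contracted by the factor [1 / (2 r)], faster than [del]. *)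
Lemma quadratic_contraction (x : nat -> R) K : 0 <= K ->
  (forall j, 0 <= x j) -> x j @[j --> \oo] --> 0 ->
  (forall j, x j.+1 <= K * (x j ^+ 2 + del j)) ->
  exists2 L : R, 0 <= L & \forall j \near \oo, x j <= L * del j.
Proof.
move=> K0 x0 xc H; have r0 : 0 < r by rewrite (lt_trans _ r1).
(* below [e] the quadratic term is at most [x / (2 r)] *)
pose e := (2 * r * (K + 1))^-1.
have K1 : 0 < K + 1 by rewrite ltr_wpDl.
have e0 : 0 < e by rewrite invr_gt0 !mulr_gt0.
have [J _ HJ] : \forall j \near \oo, x j < e by exact: (cvgr_lt _ xc).
pose L := x J / del J + 2 * K * r.
have L0 : 0 <= L by rewrite addr_ge0 ?divr_ge0 ?mulr_ge0.
exists L => //; exists J => // j /= Jj; rewrite -(subnKC Jj).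
elim: (j - J)%N => [|i IH].
  rewrite addn0 /L mulrDl divfK ?gt_eqF // lerDl !mulr_ge0 //.
rewrite addnS delS; apply: (le_trans (H _)).
have xe : x (J + i)%N < e by apply: HJ; rewrite /= leq_addr.
have : K * x (J + i)%N ^+ 2 <= (2 * r)^-1 * x (J + i)%N.
  rewrite expr2 mulrA ler_wpM2r //.
  apply: (@le_trans _ _ ((K + 1) * e)).
    by apply: ler_pM => //; [rewrite lerDl ler01 | exact: ltW].
  by rewrite /e invfM mulrCA divff ?mulr1 ?gt_eqF.
have h : (2 * r)^-1 * x (J + i)%N <= (2 * r)^-1 * (L * del (J + i)%N).
  by rewrite ler_wpM2l // invr_ge0 mulr_ge0 // ltW.
have LK : 2 * K * r <= L by rewrite /L lerDr divr_ge0 // ltW.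
have : K * del (J + i)%N <= L / 2 * (del (J + i)%N / r).
  have -> : K * del (J + i)%N = (2 * K * r) / 2 * (del (J + i)%N / r).
    by field; rewrite gt_eqF.
  rewrite ler_wpM2r ?divr_ge0 //; move: LK; lra.
have hE : (2 * r)^-1 * (L * del (J + i)%N) = L / 2 * (del (J + i)%N / r).
  by field; rewrite gt_eqF.
by move: h; rewrite hE; lra.
Qed.

(** The finitely many exceptional indices are absorbed into the constant. *)
Lemma eventually_lower_bound (h : nat -> R) a : 0 <= a ->
  (\forall j \near \oo, - (a * del j ^+ 2) <= h j) ->
  exists2 a' : R, 0 <= a' & forall j, - (a' * del j ^+ 2) <= h j.
Proof.
move=> a0 [J _ HJ]; pose s := \sum_(i < J) `|h i| / del i ^+ 2.
have t0 i : 0 <= `|h i| / del i ^+ 2 by rewrite divr_ge0 ?sqr_ge0.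
have s0 : 0 <= s by apply: sumr_ge0.
exists (a + s) => [|j]; first by rewrite addr_ge0.
have d2 : 0 < del j ^+ 2 by rewrite exprn_gt0.
have [jJ|Jj] := ltnP j J; last first.
  by apply: le_trans (HJ j Jj); rewrite lerN2 mulrDl lerDl mulr_ge0 ?sqr_ge0.
have : `|h j| / del j ^+ 2 <= a + s.
  rewrite ler_wpDl // /s (bigD1 (Ordinal jJ)) //= lerDl.
  by apply: sumr_ge0.
rewrite ler_pdivrMr // => hs; rewrite lerNl (le_trans _ hs) //.
by rewrite -normrN ler_norm.
Qed.

End GeometricErrors.

Lemma quadratic_inequality_bound (R : realFieldType) (a t Q q : R) :
  0 < t -> 0 <= a -> 0 <= Q -> 0 <= q ->
  a ^+ 2 <= Q * ((a + q * t) * t) -> a <= (Q + q + 1) * t.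
Proof.
move=> t0 a0 Q0 q0 h; rewrite leNgt; apply/negP => ha.
have s0 : 0 <= Q + q + 1 by rewrite !addr_ge0.
have t0' := ltW t0.
have h1 : a * ((Q + q + 1) * t) < a ^+ 2.
  by rewrite expr2 ltr_pM2l // (le_lt_trans _ ha) // mulr_ge0 // ltW.
have h2 : (q + 1) * t * ((Q + q + 1) * t) <= (q + 1) * t * a.
  by rewrite ler_wpM2l ?(ltW ha) // mulr_ge0 ?addr_ge0.
have h3 : 0 <= t * t * (q * q + Q + 2 * q + 1).
  by rewrite !(mulr_ge0, addr_ge0).
lra.
Qed.

(** With [d <= k t (a + q t)], every term on the right of the last hypothesis has
    a factor [t], which cancels against the left, and a further factor of order
    [x^2 + t]; what is left has the shape of [quadratic_inequality_bound].  The
    bounds [S] and [e] only serve to absorb higher-order terms. *)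
Lemma gap_quadratic_arith (R : realFieldType) (K k q c r S e : R) :
  0 <= K -> 0 <= k -> 0 <= q -> 0 <= c -> 0 < r -> 0 <= S -> 0 <= e ->
  exists2 L : R, 0 <= L & forall a x t d : R,
    0 <= a <= S -> 0 <= x -> 0 < t <= e -> 0 <= d <= k * t * (a + q * t) ->
    t / r * a ^+ 2 <= K * ((x + c * t) ^+ 2 * d + d ^+ 2) + t / r * a * (c * t) ->
    a <= L * (x ^+ 2 + t).
Proof.
move=> K0 k0 q0 c0 r0 S0 e0.
pose P := 2 + 2 * c ^+ 2 * e + k * (S + q * e).
have P0 : 0 <= P.
  by rewrite /P !addr_ge0 ?mulr_ge0 ?addr_ge0 ?mulr_ge0 ?sqr_ge0.
have r0' := ltW r0; pose Q := r * K * k * P + c.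
have Q0 : 0 <= Q by rewrite /Q addr_ge0 // !mulr_ge0.
exists (Q + q + 1); first exact: addr_ge0 (addr_ge0 Q0 q0) ler01.
move=> a x t d /andP[a0 aS] x0 /andP[t0 te] /andP[d0 dk] h.
have t0' := ltW t0; set T := x ^+ 2 + t.
have x2 := sqr_ge0 x.
have tT : t <= T by rewrite lerDr.
have T0 : 0 < T by apply: lt_le_trans tT.
apply: quadratic_inequality_bound => //.
have c2 := sqr_ge0 c.
have b1 : (x + c * t) ^+ 2 + d <= P * T.
  have u1 : (x + c * t) ^+ 2 <= 2 * x ^+ 2 + 2 * c ^+ 2 * (t * t).
    by have := sqr_ge0 (x - c * t); lra.
  have u2 : 2 * c ^+ 2 * (t * t) <= 2 * c ^+ 2 * (e * t).
    by rewrite ler_wpM2l ?mulr_ge0 // ler_wpM2r.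
  have u3 : k * t * (a + q * t) <= k * t * (S + q * e).
    by rewrite ler_wpM2l ?mulr_ge0 // lerD // ler_wpM2l.
  have u4 : 0 <= (2 * c ^+ 2 * e + k * (S + q * e)) * x ^+ 2.
    by rewrite !(mulr_ge0, addr_ge0).
  have u5 : 0 <= 2 * t by rewrite mulr_ge0.
  rewrite /P /T; lra.
have b2 : K * ((x + c * t) ^+ 2 * d + d ^+ 2) <= K * (k * t * (a + q * t)) * (P * T).
  have -> : K * ((x + c * t) ^+ 2 * d + d ^+ 2) = K * d * ((x + c * t) ^+ 2 + d) by ring.
  apply: ler_pM => //; rewrite ?mulr_ge0 ?addr_ge0 ?sqr_ge0 //.
  by rewrite ler_wpM2l.
have b3 : a ^+ 2 <= r * (K * (k * (a + q * t)) * (P * T)) + a * (c * t).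
  have rt : 0 < t / r by rewrite divr_gt0.
  rewrite -(ler_pM2l rt); apply: (le_trans h).
  have -> : t / r * (r * (K * (k * (a + q * t)) * (P * T)) + a * (c * t))
    = K * (k * t * (a + q * t)) * (P * T) + t / r * a * (c * t).
    by field; rewrite gt_eqF.
  by rewrite lerD2r.
apply: (le_trans b3); rewrite /Q [leRHS]mulrDl; apply: lerD.
  have -> : r * (K * (k * (a + q * t)) * (P * T)) = r * K * k * P * ((a + q * t) * T) by ring.
  by rewrite ler_wpM2l ?mulr_ge0 // ler_wpM2r ?(ltW T0) // lerD2l ler_wpM2l.
rewrite mulrCA ler_wpM2l //; apply: ler_pM => //.
by rewrite lerDl mulr_ge0 // ltW.
Qed.

(** * Limits in the Frobenius norm *)

Section NormLimits.
Variable R : realType.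
Implicit Types m n : nat.

Lemma cvg_frobenius (T : Type) (F : set_system T) m n (A : T -> 'M[R]_(m, n))
    (L : 'M[R]_(m, n)) : ProperFilter F ->
  A t @[t --> F] --> L -> frobenius_norm (A t) @[t --> F] --> frobenius_norm L.
Proof.
move=> PF AL.
have E (M : 'M[R]_(m, n)) : frobenius_norm M = Num.sqrt (mxinner M M).
  by rewrite -frobenius_sqr sqrtr_sqr ger0_norm // frobenius_ge0.
rewrite E (_ : (fun t => _) = fun t => Num.sqrt (mxinner (A t) (A t))); last first.
  by apply/funext => t; rewrite E.
by apply: continuous_cvg; [exact: sqrt_continuous | exact: cvg_mxinner].
Qed.

Lemma frobenius_cvg0 (T : Type) (F : set_system T) m n (A : T -> 'M[R]_(m, n)) :
  ProperFilter F ->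
  frobenius_norm (A t) @[t --> F] --> 0 -> A t @[t --> F] --> (0 : 'M[R]_(m, n)).
Proof.
move=> PF AL; apply/mx_cvgP => i j; rewrite mxE.
apply/norm_cvg0P; apply: (squeeze_cvgr _ (cvg_cst 0) AL).
by apply: nearW => t; rewrite normr_ge0 entry_le_frobenius.
Qed.

Lemma frobenius_bounded_of_entries m n (t : R) : exists2 M : R, 0 <= M &
  forall A : 'M[R]_(m, n), (forall i j, `|A i j| <= t) -> frobenius_norm A <= M.
Proof.
pose B : R := \sum_(i < m) \sum_(j < n) t ^+ 2.
have B0 : 0 <= B by do 2![apply: sumr_ge0 => ? _]; rewrite sqr_ge0.
exists (B + 1) => [|A At]; first by rewrite addr_ge0.
rewrite -(@ler_pXn2r _ 2) ?nnegrE ?frobenius_ge0 ?addr_ge0 //.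
apply: (@le_trans _ _ B); last by nra.
rewrite frobenius_sqr mxinnerE; apply: ler_sum => i _; apply: ler_sum => j _.
rewrite -expr2 -real_normK ?num_real // ler_pXn2r ?nnegrE //.
exact: le_trans (At i j).
Qed.

Lemma dual_ball_bounded m n (tau : R) : exists2 M : R, 0 <= M &
  forall Y : 'M[R]_(m, n), dual_ball tau Y -> frobenius_norm Y <= M.
Proof.
have [M M0 HM] := frobenius_bounded_of_entries m n tau.
exists M => // Y bY; apply: HM => i j.
have e1 k (l : 'I_k) : mxinner (delta_mx l 0 : 'cV[R]_k) (delta_mx l 0) = 1.
  rewrite mxinnerE (bigD1 l) //= big_ord1 !mxE !eqxx mulr1 big1 ?addr0 // => i' il.
  by rewrite big_ord1 !mxE (negbTE il) mul0r.
have Yij : mxinner (delta_mx i 0 : 'cV[R]_m) (Y *m delta_mx j 0) = Y i j.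
  rewrite -colE mxinnerE (bigD1 i) //= big_ord1 !mxE !eqxx mul1r big1 ?addr0 // => i' il.
  by rewrite big_ord1 !mxE (negbTE il) mul0r.
have := bY (delta_mx i 0) (delta_mx j 0).
have := bY (- delta_mx i 0) (delta_mx j 0).
rewrite !mxinner_lin !opprK !e1 Yij ler_norml => h1 h2.
apply/andP; split; lra.
Qed.

Lemma mx_cvg_bounded m n (A : nat -> 'M[R]_(m, n)) (L : 'M[R]_(m, n)) :
  A k @[k --> \oo] --> L ->
  exists2 M : R, 0 <= M & forall k, frobenius_norm (A k) <= M.
Proof.
move=> AL; have Ac := cvg_frobenius _ AL.
have /cvg_seq_bounded [M [Mr HM]] : cvgn (fun k => frobenius_norm (A k)).
  by apply/cvg_ex; exists (frobenius_norm L); exact: Ac.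
have H k : frobenius_norm (A k) <= `|M| + 1.
  have := HM (`|M| + 1); rewrite ltr_pwDr ?ler_norm // => /(_ isT k Logic.I).
  by rewrite /= ger0_norm ?frobenius_ge0.
by exists (`|M| + 1); rewrite ?addr_ge0.
Qed.

Lemma dual_ball_closed m n tau
    (Y : nat -> 'M[R]_(m, n)) (Z : 'M[R]_(m, n)) :
  Y t @[t --> \oo] --> Z -> (forall t, dual_ball tau (Y t)) -> dual_ball tau Z.
Proof.
move=> YZ bY a b.
have c : - mxinner a (Y t *m b) @[t --> \oo] --> - mxinner a (Z *m b).
  apply: cvgN; apply: cvg_mxinner; first exact: cvg_cst.
  by apply: cvg_mulmx => //; exact: cvg_cst.
apply: (ler_cvg_to c (cvg_cst _)).
by apply: nearW => t; exact: bY.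
Qed.

Lemma slack_dilation_closed m n tau
    (Y D : nat -> 'M[R]_(m, n)) (Z D0 : 'M[R]_(m, n)) a b :
  Y t @[t --> \oo] --> Z -> D t @[t --> \oo] --> D0 ->
  (forall t, slack_dilation tau (Y t) (D t) a b <= 0) ->
  slack_dilation tau Z D0 a b <= 0.
Proof.
move=> YZ DD0 H.
have mulc k l (A : nat -> 'M[R]_(k, l)) (A0 : 'M[R]_(k, l)) (w : nat -> 'cV[R]_l) (w0 : 'cV[R]_l) :
    A t @[t --> \oo] --> A0 -> w t @[t --> \oo] --> w0 ->
    A t *m w t @[t --> \oo] --> A0 *m w0 by exact: cvg_mulmx.
have c : slack_dilation tau (Y t) (D t) a b @[t --> \oo]
    --> slack_dilation tau Z D0 a b.
  rewrite /slack_dilation.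
  have Yb : Y t *m b @[t --> \oo] --> Z *m b by apply: mulc => //; exact: cvg_cst.
  have Ya : (Y t)^T *m a @[t --> \oo] --> Z^T *m a.
    by apply: mulc; [exact: cvg_trmx | exact: cvg_cst].
  have Db : D t *m b @[t --> \oo] --> D0 *m b by apply: mulc => //; exact: cvg_cst.
  have Da : (D t)^T *m a @[t --> \oo] --> D0^T *m a.
    by apply: mulc; [exact: cvg_trmx | exact: cvg_cst].
  apply: cvgD; apply: cvg_mxinner.
  - by apply: cvgD => //; exact: cvg_cst.
  - by apply: cvgD; [apply: cvgZl_tmp | exact: mulc].
  - by apply: cvgD => //; exact: cvg_cst.
  - by apply: cvgD; [apply: cvgZl_tmp | apply: mulc => //; exact: cvg_trmx].
apply: (ler_cvg_to c (cvg_cst _)).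
by apply: nearW => t; exact: H.
Qed.

End NormLimits.

(** * Convergence of the alternating scheme *)

Section AlternatingConvergence.
(** The relations between consecutive iterates, freed from the closed forms:
    [del] stands for [1 / mu], [B] for [C W^-1], and [H] is the gradient of
    the quadratic term transported to the variable [B].  Only indices from 1 on
    carry a dual pair, since no thresholding step produces [D 0]. *)
Variables (R : realType) (m n : nat) (tau rho : R) (W : 'M[R]_n).
Variables (X Coo Doo : 'M[R]_(m, n)) (C D Y : nat -> 'M[R]_(m, n)).
Variables (B H : nat -> 'M[R]_(m, n)) (del : nat -> R).
Hypotheses (tau0 : 0 < tau) (rho1 : 1 < rho) (del0 : forall j, 0 < del j).
Hypothesis delS : forall j, del j.+1 = del j / rho.
Hypothesis CB : forall j, C j = B j *m W.
Hypothesis HE : forall j, H j = (C j - X *m W) *m W^T.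
Hypothesis dualYD : forall j, nuclear_dual_pair tau (Y j.+1) (D j.+1).
Hypothesis ballY : forall j, dual_ball tau (Y j).
Hypothesis stepY : forall j, D j.+1 - B j.+1 = del j *: (Y j.+1 - Y j).
Hypothesis stepD : forall j, D j - D j.+1 = del j *: (H j.+1 - Y j.+1).
Hypothesis Ccvg : C j @[j --> \oo] --> Coo.
Hypothesis Dcvg : D j @[j --> \oo] --> Doo.
Hypothesis nuccvg :
  nuclear_norm (D j) @[j --> \oo] --> nuclear_norm Doo.

Local Notation "`[ M ]" := (frobenius_norm M) (at level 0, format "`[ M ]").
Local Notation "<< M , N >>" := (mxinner M N) (at level 0).

Local Notation A := (X *m W).
Local Notation obj := (objective X W tau).

Let Hoo := (Coo - A) *m W^T.
Let G j := H j - Y j.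
Let kap := rho / (rho - 1).

Let del_ge0 j : 0 <= del j. Proof. exact: ltW. Qed.
Let delS_le j : del j.+1 <= del j. Proof. exact: (geometric_step_le rho1 del0 delS). Qed.
Let rho_gt0 : 0 < rho. Proof. exact: lt_trans rho1. Qed.
Let kap_ge0 : 0 <= kap.
Proof. by rewrite divr_ge0 ?subr_ge0 ?ltW. Qed.

Let fro0 k l (M : 'M[R]_(k, l)) : 0 <= `[M]. Proof. exact: frobenius_ge0. Qed.
Hint Resolve fro0 del_ge0 kap_ge0 : core.

Let Hcvg : H j @[j --> \oo] --> Hoo.
Proof.
rewrite (_ : H = fun j => (C j - A) *m W^T); last exact/funext.
apply: cvg_mulmx; last exact: cvg_cst.
by apply: cvgB => //; exact: cvg_cst.
Qed.

Let bounded : exists M : R, [/\ 0 <= M, forall j, `[Y j] <= M,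
  forall j, `[H j] <= M, forall j, `[D j] <= M & `[Hoo] <= M].
Proof.
have [M1 M10 HM1] := dual_ball_bounded m n tau.
have [M2 M20 HM2] := mx_cvg_bounded Hcvg.
have [M3 M30 HM3] := mx_cvg_bounded Dcvg.
exists (M1 + M2 + M3 + `[Hoo]); have h := fro0 Hoo; split => [|j|j|j|]; first by rewrite !addr_ge0.
- by have := HM1 _ (ballY j); lra.
- by have := HM2 j; lra.
- by have := HM3 j; lra.
- lra.
Qed.

Let incrD j : `[D j - D j.+1] = del j * `[G j.+1].
Proof. by rewrite stepD frobeniusZ ger0_norm. Qed.

(** [|D i - D i.+1| = del i |G i.+1|], and the [del i] sum up to [kap * del j]. *)
Lemma tail_rate L j : 0 <= L -> (forall i, (j <= i)%N -> `[G i.+2] <= L) ->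
  `[D j.+1 - Doo] <= L * kap * del j.
Proof.
move=> L0 GL.
have c : `[D j.+1 - D i.+1] @[i --> \oo] --> `[D j.+1 - Doo].
  apply: cvg_frobenius; apply: cvgB; first exact: cvg_cst.
  by rewrite (@cvg_shiftS _ D).
have := geometric_limit_le rho1 del0 delS L0 _ c; move=> /(_ j).
rewrite subrr frobenius0 add0r.
apply=> i ji; apply: (le_trans (frobenius_triangle (D i.+1) _ _)).
rewrite lerD2l incrD mulrC; apply: ler_pM => //; exact: GL.
Qed.

(** [D j - B j] is [del] times an increment of the bounded sequence [Y]. *)
Lemma limits_coupled : Coo = Doo *m W.
Proof.
have [M M0 HM] := dual_ball_bounded m n tau; have YM j := HM _ (ballY j).
have E0 : D j.+1 - B j.+1 @[j --> \oo] --> (0 : 'M[R]_(m, n)).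
  apply: frobenius_cvg0.
  have z : 2 * M * del j @[j --> \oo] --> 0.
    rewrite -(mulr0 (2 * M)); apply: cvgM; first exact: cvg_cst.
    exact: geometric_cvg0 delS.
  apply: (squeeze_cvgr _ (cvg_cst 0) z); apply: nearW => j.
  rewrite fro0 /= stepY frobeniusZ ger0_norm // mulrC ler_wpM2r //.
  by have := frobeniusB (Y j.+1) (Y j); have := YM j.+1; have := YM j; lra.
have E1 : (D j.+1 - B j.+1) *m W @[j --> \oo] --> (0 : 'M[R]_(m, n)) *m W.
  by apply: cvg_mulmx => //; exact: cvg_cst.
have E2 : (D j.+1 - B j.+1) *m W @[j --> \oo] --> Doo *m W - Coo.
  rewrite (_ : (fun j => _) = fun j => D j.+1 *m W - C j.+1); last first.
    by apply/funext => j; rewrite mulmxBl CB.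
  apply: cvgB; last by rewrite (@cvg_shiftS _ C).
  by apply: cvg_mulmx; [rewrite (@cvg_shiftS _ D) | exact: cvg_cst].
apply/esym/subr0_eq; rewrite -[RHS](mul0mx _ W); exact: mx_cvg_unique E2 E1.
Qed.

(** One constant for all the first-order rates. *)
Let rates : exists c : R, [/\ 0 <= c, forall j, `[D j.+1 - Doo] <= c * del j,
  forall j, `[D j.+1 - B j.+1] <= c * del j,
  forall j, `[C j.+1 - Coo] <= c * del j &
  forall j, `[H j.+1 - Hoo] <= c * del j].
Proof.
have [M [M0 YM HM _ _]] := bounded.
have GM j : `[G j] <= 2 * M.
  by have := frobeniusB (H j) (Y j); have := YM j; have := HM j; rewrite /G; lra.
have M20 : 0 <= 2 * M by rewrite mulr_ge0.
have r1 j : `[D j.+1 - Doo] <= 2 * M * kap * del j by apply: tail_rate => // i _.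
have r2 j : `[D j.+1 - B j.+1] <= 2 * M * del j.
  rewrite stepY frobeniusZ ger0_norm // mulrC ler_wpM2r //.
  by have := frobeniusB (Y j.+1) (Y j); have := YM j.+1; have := YM j; lra.
pose c3 := (2 * M * kap + 2 * M) * `[W].
have kM : 0 <= 2 * M * kap by exact: mulr_ge0.
have c30 : 0 <= c3 by apply: mulr_ge0 => //; exact: addr_ge0.
have r3 j : `[C j.+1 - Coo] <= c3 * del j.
  rewrite CB limits_coupled -mulmxBl; apply: (le_trans (frobeniusM _ _)).
  rewrite /c3 mulrAC ler_wpM2r //; apply: (le_trans (frobenius_triangle (D j.+1) _ _)).
  by rewrite frobeniusBC; have := r1 j; have := r2 j; lra.
pose c4 := c3 * `[W].
have r4 j : `[H j.+1 - Hoo] <= c4 * del j.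
  rewrite HE /Hoo -mulmxBl; apply: (le_trans (frobeniusM _ _)).
  rewrite frobeniusT /c4 mulrAC ler_wpM2r // opprB addrA subrK; exact: r3.
have c40 : 0 <= c4 by exact: mulr_ge0.
exists (2 * M * kap + 2 * M + c3 + c4); split=> [|j|j|j|j].
- by rewrite !addr_ge0.
- apply: (le_trans (r1 j)); rewrite ler_wpM2r //; lra.
- apply: (le_trans (r2 j)); rewrite ler_wpM2r //; lra.
- apply: (le_trans (r3 j)); rewrite ler_wpM2r //; lra.
- apply: (le_trans (r4 j)); rewrite ler_wpM2r //; lra.
Qed.

Let dual_limit j : - <<Y j, Doo>> <= tau * nuclear_norm Doo.
Proof.
have c1 : - <<Y j, D i.+1>> @[i --> \oo] --> - <<Y j, Doo>>.
  apply: cvgN; apply: cvg_mxinner; first exact: cvg_cst.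
  by rewrite (@cvg_shiftS _ D).
have c2 : tau * nuclear_norm (D i.+1) @[i --> \oo] --> tau * nuclear_norm Doo.
  apply: cvgM; first exact: cvg_cst.
  by rewrite (@cvg_shiftS _ (fun i => nuclear_norm (D i))).
apply: (ler_cvg_to c1 c2); apply: nearW => i.
exact: nuclear_dual_le (dualYD i) (ballY j).
Qed.

(** The quadratic term is Lipschitz near [Coo]; for the nuclear norm,
    [tau |D|_* - tau |Doo|_* <= - <Y, D - Doo>] since [-Y] norms [D] and lies in
    the dual ball. *)
Lemma objective_upper_bound : exists2 b : R, 0 <= b &
  forall j, obj (C j.+1) (D j.+1) - obj Coo Doo <= b * del j.
Proof.
have [M [M0 YM _ _ _]] := bounded.
have [c [c0 rD _ rC _]] := rates.
exists (`[A - Coo] * c + c * c * del 0%N + M * c).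
  by rewrite !addr_ge0 // !mulr_ge0.
move=> j; rewrite /objective.
have -> : A - C j.+1 = (A - Coo) - (C j.+1 - Coo) by rewrite opprB addrA subrK.
have := rC j; move: (C j.+1 - Coo) (A - Coo) => e a eb.
rewrite !frobenius_sqr !mxinner_lin (mxinnerC e) (nuclear_dual_eq (dualYD j)).
have h1 := dual_limit j.+1.
have h2 := normr_mxinner_le a e; have h3 := mxinner_le_frobenius e e.
have h4 := normr_mxinner_le (Y j.+1) (D j.+1 - Doo).
have h5 : `[a] * `[e] <= `[a] * (c * del j) by rewrite ler_wpM2l.
have h6 : `[e] * `[e] <= (c * del j) * (c * del 0%N).
  apply: ler_pM => //; apply: (le_trans eb); rewrite ler_wpM2l //.
  by rewrite -[j]add0n (geometric_le rho1 del0 delS).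
have h7 : `[Y j.+1] * `[D j.+1 - Doo] <= M * (c * del j) by apply: ler_pM.
have h8 : 0 <= c * c * del 0%N * del j by rewrite !mulr_ge0.
move: h2 h4; rewrite !ler_norml mxinnerBr => /andP[h21 h22] /andP[h41 h42].
lra.
Qed.

Let obj_cvg : obj (C j.+1) (D j.+1) @[j --> \oo] --> obj Coo Doo.
Proof.
apply: cvgD; apply: cvgM; try exact: cvg_cst; last first.
  by rewrite (@cvg_shiftS _ (fun i => nuclear_norm (D i))).
have c : `[A - C j.+1] @[j --> \oo] --> `[A - Coo].
  apply: cvg_frobenius; apply: cvgB; first exact: cvg_cst.
  by rewrite (@cvg_shiftS _ C).
by under eq_fun do rewrite expr2; rewrite expr2; apply: cvgM.
Qed.

(** Convexity of both terms at the new iterate.  The gradients [H] and [-Y] are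
    tested against the increments of [B] and of [D] respectively; replacing the
    former by the latter costs the difference of the residuals [D - B] and
    leaves [<G, D k.+1 - D k.+2> = del |G|^2]. *)
Lemma descent_inequality k :
  obj (C k.+2) (D k.+2) + del k.+1 * `[G k.+2] ^+ 2
    <= obj (C k.+1) (D k.+1)
       + <<H k.+2, (D k.+1 - B k.+1) - (D k.+2 - B k.+2)>>.
Proof.
have Cgrad : <<C k.+2 - A, C k.+1 - C k.+2>> = <<H k.+2, B k.+1 - B k.+2>>.
  by rewrite HE mxinnerMr trmxK mulmxBl -!CB.
have Csq : `[A - C k.+2] ^+ 2 + 2 * <<C k.+2 - A, C k.+1 - C k.+2>> <= `[A - C k.+1] ^+ 2.
  rewrite (frobeniusBC A (C k.+1)) (frobeniusBC A (C k.+2)).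
  have -> : C k.+1 - A = (C k.+2 - A) + (C k.+1 - C k.+2) by rewrite [RHS]addrC addrA subrK.
  move: (C k.+2 - A) (C k.+1 - C k.+2) => a b.
  rewrite !frobenius_sqr !mxinner_lin (mxinnerC b a).
  by have := mxinner_ge0 b; lra.
have nuc1 := nuclear_dual_le (dualYD k) (ballY k.+2).
have nuc2 := nuclear_dual_eq (dualYD k.+1).
have GG : del k.+1 * `[G k.+2] ^+ 2 = <<H k.+2 - Y k.+2, D k.+1 - D k.+2>>.
  by rewrite stepD mxinnerZr frobenius_sqr.
rewrite /objective GG; move: Csq; rewrite Cgrad !mxinnerBr !mxinnerBl => Csq.
lra.
Qed.

(** Adding the linear correction makes the descent inequality telescope, up to
    errors of order [del ^+ 2]. *)
Let Phi j := obj (C j.+1) (D j.+1) + <<Hoo, D j.+1 - B j.+1>>.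

Let lower : exists2 c : R, 0 <= c &
  forall j, obj Coo Doo + del j.+1 * `[G j.+2] ^+ 2
    <= obj (C j.+1) (D j.+1) + <<Hoo, D j.+1 - B j.+1>> + c * del j ^+ 2.
Proof.
have [c [c0 _ rE _ rH]] := rates.
pose c1 := 2 * c * c; have c10 : 0 <= c1 by rewrite /c1 !mulr_ge0.
have step j : Phi j.+1 + del j.+1 * `[G j.+2] ^+ 2 <= Phi j + c1 * del j ^+ 2.
  have d1 := descent_inequality j; rewrite /Phi.
  set e1 := D j.+1 - B j.+1 in d1 *; set e2 := D j.+2 - B j.+2 in d1 *.
  have h1 : `[H j.+2 - Hoo] <= c * del j.
    by apply: (le_trans (rH j.+1)); rewrite ler_wpM2l.
  have h2 : `[e1 - e2] <= 2 * c * del j.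
    apply: (le_trans (frobeniusB _ _)); have := rE j; have := rE j.+1.
    have := ler_wpM2l c0 (delS_le j); rewrite -/e1 -/e2; lra.
  have h3 := mxinner_le_frobenius (H j.+2 - Hoo) (e1 - e2).
  have h4 : `[H j.+2 - Hoo] * `[e1 - e2] <= (c * del j) * (2 * c * del j) by apply: ler_pM.
  move: d1 h3; rewrite mxinnerBl !mxinnerBr /c1; move: e1 e2 h2 h4 => e1 e2 h2 h4.
  lra.
have E0 : <<Hoo, D j.+1 - B j.+1>> @[j --> \oo] --> 0.
  apply/norm_cvg0P.
  have z : `[Hoo] * c * del j @[j --> \oo] --> 0.
    rewrite -(mulr0 (`[Hoo] * c)); apply: cvgM; first exact: cvg_cst.
    exact: geometric_cvg0 delS.
  apply: (squeeze_cvgr _ (cvg_cst 0) z); apply: nearW => j.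
  rewrite normr_ge0 /=; apply: (le_trans (normr_mxinner_le _ _)).
  by rewrite -mulrA ler_wpM2l.
have Pcvg : Phi j @[j --> \oo] --> obj Coo Doo.
  by rewrite -[obj Coo Doo]addr0; apply: cvgD.
have rho2 : 1 < rho ^+ 2 by rewrite expr_gt1 // ltW.
have d20 j : 0 < del j ^+ 2 by rewrite exprn_gt0.
have d2S j : del j.+1 ^+ 2 = del j ^+ 2 / rho ^+ 2 by rewrite delS expr_div_n.
pose k2 := rho ^+ 2 / (rho ^+ 2 - 1).
have k20 : 0 <= k2 by rewrite divr_ge0 ?subr_ge0 ?ltW // exprn_gt0.
exists (c1 * k2 + c1) => [|j]; first by rewrite addr_ge0 // mulr_ge0.
have stepP i : Phi i.+1 <= Phi i + c1 * del i ^+ 2.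
  have := step i; have : 0 <= del i.+1 * `[G i.+2] ^+ 2 by rewrite mulr_ge0 ?sqr_ge0.
  lra.
have := @geometric_limit_le _ _ _ rho2 d20 d2S Phi c1 j.+1 _ c10 (fun i _ => stepP i) Pcvg.
rewrite -/k2 => h1; have h2 := step j.
have h3 : c1 * k2 * del j.+1 ^+ 2 <= c1 * k2 * del j ^+ 2.
  by apply: ler_wpM2l; [exact: mulr_ge0 | rewrite ler_pXn2r ?nnegrE].
rewrite -/(Phi j); lra.
Qed.

(** The subdifferential of the nuclear norm is monotone, so [Y j.+2 - Y j.+1] has
    a nonnegative inner product with [D j.+1 - D j.+2], hence with [G j.+2]. *)
Lemma gap_monotone j :
  `[G j.+2] ^+ 2 + `[G j.+2 - G j.+1] ^+ 2
    <= `[G j.+1] ^+ 2 + 2 * <<G j.+2, H j.+2 - H j.+1>>.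
Proof.
have mono : 0 <= <<G j.+2, Y j.+2 - Y j.+1>>.
  have h1 := nuclear_dual_le (dualYD j) (ballY j.+2).
  have h2 := nuclear_dual_le (dualYD j.+1) (ballY j.+1).
  have h3 := nuclear_dual_eq (dualYD j); have h4 := nuclear_dual_eq (dualYD j.+1).
  rewrite -(pmulr_rge0 _ (del0 j.+1)) -mxinnerZl -stepD !mxinnerBr !mxinnerBl.
  rewrite !(mxinnerC _ (Y _)); lra.
have E : Y j.+2 - Y j.+1 = (H j.+2 - H j.+1) - (G j.+2 - G j.+1).
  by rewrite /G opprB !addrA; apply/matrixP => a b; rewrite !mxE; ring.
move: mono; rewrite E; move: (G j.+2) (G j.+1) (H j.+2 - H j.+1) => g2 g1 h.
rewrite !frobenius_sqr !mxinner_lin (mxinnerC g1 g2); lra.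
Qed.

Let gap_steps : exists c : R, [/\ 0 <= c,
  forall j, `[G j.+2] ^+ 2 + `[G j.+2 - G j.+1] ^+ 2 <= `[G j.+1] ^+ 2 + c * del j,
  forall j, `[G j.+2] <= `[G j.+1] + c * del j &
  forall j, `[H j.+2 - H j.+1] <= c * del j].
Proof.
have [M [M0 YM HM _ _]] := bounded; have [c [c0 _ _ _ rH]] := rates.
have GM j : `[G j] <= 2 * M.
  by have := frobeniusB (H j) (Y j); have := YM j; have := HM j; rewrite /G; lra.
have hh j : `[H j.+2 - H j.+1] <= 2 * c * del j.
  apply: (le_trans (frobenius_triangle Hoo _ _)); rewrite [X in _ + X]frobeniusBC.
  by have := rH j; have := rH j.+1; have := ler_wpM2l c0 (delS_le j); lra.
have c80 : 0 <= 8 * M * c by rewrite !mulr_ge0.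
have hd j : 0 <= 8 * M * c * del j by rewrite mulr_ge0.
have hd2 j : 0 <= c * del j by rewrite mulr_ge0.
exists (8 * M * c + 4 * c); split=> [|j|j|j].
- by rewrite addr_ge0 // mulr_ge0.
- have h1 := gap_monotone j; have h2 := mxinner_le_frobenius (G j.+2) (H j.+2 - H j.+1).
  have h3 : `[G j.+2] * `[H j.+2 - H j.+1] <= 2 * M * (2 * c * del j) by apply: ler_pM.
  by have := hd2 j; lra.
- have h1 := gap_monotone j; have h2 := mxinner_le_frobenius (G j.+2) (H j.+2 - H j.+1).
  have h3 : `[G j.+2] * `[H j.+2 - H j.+1] <= `[G j.+2] * (2 * c * del j) by rewrite ler_wpM2l.
  have h4 := sqr_ge0 `[G j.+2 - G j.+1].
  have h5 : `[G j.+2] ^+ 2 <= `[G j.+1] ^+ 2 + 4 * (c * del j) * `[G j.+2] by lra.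
  have h6 : `[G j.+2] <= `[G j.+1] + 4 * (c * del j).
    have x0 := fro0 (G j.+2); have y0 := fro0 (G j.+1); have z0 := hd2 j.
    move: `[G j.+2] `[G j.+1] (c * del j) h5 x0 y0 z0 => x y z h5 x0 y0 z0.
    by rewrite leNgt; apply/negP => h; nra.
  by have := hd j; lra.
- by have := hh j; have := hd j; have := hd2 j; lra.
Qed.


(** When [G] vanishes in the limit, [Y] tends to [Hoo], and
    [del |G|^2 = <D j.+1 - D j.+2, G j.+2>] is, up to higher order, at most
    [tau |D j.+1|_* + <Hoo, D j.+1>]: duality removes [Y j.+2], which
    lies in the dual ball, and [D j.+2], because [Hoo] lies there too.  Then
    [nuclear_curvature] applies. *)
Let gap_quadratic : `[G j] @[j --> \oo] --> 0 ->
  exists2 K : R, 0 <= K &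
    forall j, `[G j.+2] <= K * (`[G j.+1] ^+ 2 + del j).
Proof.
move=> G0; have [M [M0 YM HM DM _]] := bounded.
have [c [c0 _ _ _ rH]] := rates; have [q [q0 _ Gstep _]] := gap_steps.
have GM j : `[G j] <= 2 * M.
  by have := frobeniusB (H j) (Y j); have := YM j; have := HM j; rewrite /G; lra.
have Ycvg : Y j @[j --> \oo] --> Hoo.
  rewrite (_ : Y = fun j => H j - G j); last first.
    by apply/funext => j; rewrite /G opprB addrC subrK.
  rewrite -[Hoo]subr0; apply: cvgB => //; exact: frobenius_cvg0.
have ballH : dual_ball tau Hoo by exact: dual_ball_closed Ycvg ballY.
have anti a b : slack_dilation tau Hoo Doo a b <= 0.
  apply: (@slack_dilation_closed _ _ _ _ (fun j => Y j.+1) (fun j => D j.+1)).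
  - by rewrite (@cvg_shiftS _ Y).
  - by rewrite (@cvg_shiftS _ D).
  - by move=> j; exact: nuclear_dual_slack_dilation_le0.
have [K K0 curv] := nuclear_curvature tau0 M0 anti.
have qk0 : 0 <= q * kap by exact: mulr_ge0.
have M20 : 0 <= 2 * M by rewrite mulr_ge0.
have [L L0 HL] := gap_quadratic_arith K0 kap_ge0 qk0 c0 rho_gt0 M20 (del_ge0 0%N).
exists L => // j.
have Gtail i : (j <= i)%N -> `[G i.+2] <= `[G j.+2] + q * kap * del j.
  move=> ji; rewrite -(subnKC ji).
  have := geometric_almost_decr rho1 del0 delS (u := fun i => `[G i.+2]) (j := j) q0.
  apply=> k _; apply: (le_trans (Gstep k.+1)); rewrite lerD2l ler_wpM2l //.
have dD := @tail_rate (`[G j.+2] + q * kap * del j) j _ Gtail.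
have {}dD : `[D j.+1 - Doo] <= kap * del j * (`[G j.+2] + q * kap * del j).
  have L1 := addr_ge0 (fro0 (G j.+2)) (mulr_ge0 qk0 (del_ge0 j)).
  by apply: (le_trans (dD L1)); rewrite -mulrA mulrC.
apply: (HL `[G j.+2] `[G j.+1] (del j) `[D j.+1 - Doo]) => //.
- by rewrite fro0 GM.
- by rewrite del0 -[j]add0n (geometric_le rho1 del0 delS).
- by rewrite fro0 dD.
rewrite -delS.
have GG : del j.+1 * `[G j.+2] ^+ 2 = <<D j.+1 - D j.+2, G j.+2>>.
  by rewrite stepD mxinnerZl frobenius_sqr.
have GE : <<D j.+1 - D j.+2, G j.+2>> = <<D j.+1 - D j.+2, Hoo - Y j.+2>>
    + <<D j.+1 - D j.+2, H j.+2 - Hoo>>.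
  rewrite -mxinnerDr; congr mxinner; rewrite /G.
  by apply/matrixP => a b; rewrite !mxE; ring.
have part1 : <<D j.+1 - D j.+2, Hoo - Y j.+2>> <= tau * nuclear_norm (D j.+1) + <<Hoo, D j.+1>>.
  have h1 := nuclear_dual_le (dualYD j) (ballY j.+2).
  have h2 := nuclear_dual_le (dualYD j.+1) ballH.
  have h3 := nuclear_dual_eq (dualYD j.+1).
  rewrite !mxinnerBr !mxinnerBl !(mxinnerC (D _)); lra.
have part2 : <<D j.+1 - D j.+2, H j.+2 - Hoo>> <= del j.+1 * `[G j.+2] * (c * del j).
  apply: (le_trans (mxinner_le_frobenius _ _)); rewrite incrD ler_wpM2l ?mulr_ge0 //.
  by apply: (le_trans (rH j.+1)); rewrite ler_wpM2l.
rewrite GG GE; apply: lerD part2; apply: (le_trans part1).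
apply: (le_trans (curv _ _ (dualYD j) (DM j.+1))).
rewrite ler_wpM2l // lerD2r ler_wpM2r // ler_pXn2r ?nnegrE ?addr_ge0 ?mulr_ge0 //.
apply: (le_trans (frobenius_triangle (H j.+1) _ _)).
by rewrite addrC lerD2l frobeniusBC.
Qed.

(** The only first-order term in [lower] is [<Hoo, D - B>], that is [del] times
    [<Hoo, Y j.+2 - Y j.+1>], and [Y] moves like [- G] up to [O(del)]. *)
Let lower_of_gap_increments (a M : R) : 0 <= a -> 0 <= M -> `[Hoo] <= M ->
  (\forall j \near \oo,
    M * `[G j.+2 - G j.+1] <= `[G j.+3] ^+ 2 / rho + a * del j.+1) ->
  exists2 a' : R, 0 <= a' &
    forall j, - (a' * del j ^+ 2) <= obj (C j.+1) (D j.+1) - obj Coo Doo.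
Proof.
move=> a0 M0 HM [J _ HJ].
have [c [c0 Hc]] := lower; have [q [q0 _ _ rq]] := gap_steps.
pose a1 := c + a + M * q * rho.
have a10 : 0 <= a1 by rewrite /a1 !addr_ge0 ?mulr_ge0 // ltW.
apply: (eventually_lower_bound del0 a10).
exists J.+1 => // -[//|j] Jj; have {}Jj : (J <= j)%N by [].
have h1 := Hc j.+1.
have h2 : <<Hoo, D j.+2 - B j.+2>> <= del j.+1 * (M * (`[H j.+2 - H j.+1] + `[G j.+2 - G j.+1])).
  rewrite stepY mxinnerZr ler_wpM2l //; apply: (le_trans (mxinner_le_frobenius _ _)).
  apply: ler_pM => //.
  have -> : Y j.+2 - Y j.+1 = (H j.+2 - H j.+1) - (G j.+2 - G j.+1).
    by rewrite /G; apply/matrixP => x y; rewrite !mxE; ring.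
  exact: frobeniusB.
have h3 := HJ j Jj.
have h4 : M * `[H j.+2 - H j.+1] <= M * q * rho * del j.+1.
  have -> : M * q * rho * del j.+1 = M * (q * del j) by rewrite delS; field; rewrite gt_eqF.
  by rewrite ler_wpM2l.
have h5 : del j.+1 * (M * (`[H j.+2 - H j.+1] + `[G j.+2 - G j.+1]))
    <= del j.+1 * (M * q * rho * del j.+1 + (`[G j.+3] ^+ 2 / rho + a * del j.+1)).
  by rewrite ler_wpM2l // mulrDr lerD.
have h6 : del j.+2 * `[G j.+3] ^+ 2 = del j.+1 * (`[G j.+3] ^+ 2 / rho) by rewrite (delS j.+1); ring.
rewrite h6 in h1; rewrite /a1; lra.
Qed.

Lemma objective_lower_bound : exists2 a : R, 0 <= a &
  forall j, - (a * del j ^+ 2) <= obj (C j.+1) (D j.+1) - obj Coo Doo.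
Proof.
have [M [M0 _ _ _ HM]] := bounded; have [q [q0 Gdec _ _]] := gap_steps.
have [[l [l0 ul]] w0] := geometric_descent_cvg rho1 del0 delS q0
  (fun i => sqr_ge0 `[G i.+1]) (fun i => sqr_ge0 `[G i.+2 - G i.+1]) Gdec.
have inc0 : `[G j.+2 - G j.+1] @[j --> \oo] --> 0.
  rewrite -(@sqrtr0 R) (_ : (fun j => _) = fun j => Num.sqrt (`[G j.+2 - G j.+1] ^+ 2)).
    by apply: continuous_cvg; [exact: sqrt_continuous | exact: w0].
  by apply/funext => j; rewrite sqrtr_sqr ger0_norm.
have [l0'|ln] := eqVneq l 0.
  have G1 : `[G j.+1] @[j --> \oo] --> 0.
    rewrite -(@sqrtr0 R) -l0' (_ : (fun j => _) = fun j => Num.sqrt (`[G j.+1] ^+ 2)).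
      by apply: continuous_cvg; [exact: sqrt_continuous | exact: ul].
    by apply/funext => j; rewrite sqrtr_sqr ger0_norm.
  have G0 : `[G j] @[j --> \oo] --> 0 by rewrite -(@cvg_shiftS _ (fun j => `[G j])).
  have [K K0 HK] := gap_quadratic G0.
  have [L L0 [J _ HJ]] := quadratic_contraction rho1 del0 delS K0
    (fun j => fro0 (G j.+1)) G1 HK.
  apply: (@lower_of_gap_increments (M * (L + L * rho)) M) => //.
    by rewrite mulr_ge0 // addr_ge0 // mulr_ge0 // ltW.
  exists J => // j Jj.
  have h1 := HJ j Jj; have h2 := HJ j.+1 (leqW Jj).
  have h3 : `[G j.+2 - G j.+1] <= (L + L * rho) * del j.+1.
    apply: (le_trans (frobeniusB _ _)).
    have -> : (L + L * rho) * del j.+1 = L * del j.+1 + L * del j.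
      by rewrite delS; field; rewrite gt_eqF.
    exact: lerD.
  rewrite -mulrA (le_trans (ler_wpM2l M0 h3)) // lerDr.
  by rewrite divr_ge0 ?sqr_ge0 // ltW.
have lp : 0 < l by rewrite lt_neqAle eq_sym ln.
apply: (@lower_of_gap_increments 0 M) => //.
have l2 : l / 2 < l by lra.
have M1 : 0 < M + 1 by rewrite ltr_wpDl.
(* [M |G j.+2 - G j.+1|] falls below half the limit of [|G|^2 / rho] *)
pose e := l / 2 / rho / (M + 1); have e0 : 0 < e by rewrite !divr_gt0.
have [J1 _ HJ1] := cvgr_gt _ ul _ l2.
have [J2 _ HJ2] := cvgr_lt _ inc0 _ e0.
exists (maxn J1 J2) => // j; rewrite /= geq_max => /andP[j1 j2].
rewrite mul0r addr0.
have h1 := HJ1 j.+2 (leqW (leqW j1)); have h2 := HJ2 j j2.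
apply: (@le_trans _ _ (l / 2 / rho)); last first.
  by rewrite ler_wpM2r ?invr_ge0 ?(ltW rho_gt0) // ltW.
have -> : l / 2 / rho = (M + 1) * e by rewrite /e; field; rewrite !gt_eqF.
by apply: ler_pM => //; [rewrite lerDl | exact: ltW].
Qed.

End AlternatingConvergence.

(** * The weighted singular value thresholding iteration *)

Section WSVTStationarity.
Variables (R : realType) (m n : nat).

Lemma invmx_gramE (W : 'M[R]_n) :
  W \in unitmx -> invmx (W^T *m W) = invmx W *m (invmx W)^T.
Proof.
move=> Wu; have Gu : W^T *m W \in unitmx by rewrite unitmx_mul unitmx_tr Wu.
rewrite -[LHS]mulmx1.
have <- : (W^T *m W) *m (invmx W *m (invmx W)^T) = 1%:M.
  by rewrite mulmxA -(mulmxA W^T) mulmxV // mulmx1 trmx_inv mulmxV ?unitmx_tr.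
by rewrite mulKmx.
Qed.

(** The matrix is positive definite: [<v, v A> = |v|^2 + mu |v W^-1|^2]. *)
Lemma gram_shift_unit (W : 'M[R]_n) (mu : R) :
  W \in unitmx -> 0 < mu -> 1%:M + mu *: invmx (W^T *m W) \in unitmx.
Proof.
move=> Wu mu0; rewrite -row_free_unit; apply: inj_row_free => v.
rewrite invmx_gramE // mulmxDr mulmx1 -scalemxAr mulmxA => v0.
have : mxinner v v + mu * mxinner (v *m invmx W) (v *m invmx W) = 0.
  by rewrite mxinnerMr -mxinnerZr -mxinnerDr v0 -(scale0r v) mxinnerZr mul0r.
have h1 := mxinner_ge0 v; have h2 := mxinner_ge0 (v *m invmx W).
have h3 : 0 <= mu * mxinner (v *m invmx W) (v *m invmx W) by rewrite mulr_ge0 // ltW.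
move=> h; have {h1 h2 h3}vv : mxinner v v = 0 by lra.
apply/matrixP => i j; rewrite mxE; apply/eqP; rewrite -normr_le0.
apply: (le_trans (entry_le_frobenius v i j)).
have /eqP : frobenius_norm v ^+ 2 = 0 by rewrite frobenius_sqr.
by rewrite sqrf_eq0 => /eqP ->.
Qed.

(** The closed form of the update is the vanishing of the gradient in [C]. *)
Lemma C_update_stationary (X D Y C : 'M[R]_(m, n)) (W : 'M[R]_n) mu :
  W \in unitmx -> 0 < mu ->
  C = (X *m W + mu *: (D *m (invmx W)^T) + Y *m (invmx W)^T)
        *m invmx (1%:M + mu *: invmx (W^T *m W)) ->
  (C - X *m W) *m W^T = Y + mu *: (D - C *m invmx W).
Proof.
move=> Wu mu0 CE; have Su := gram_shift_unit Wu mu0.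
have : C *m (1%:M + mu *: invmx (W^T *m W))
    = X *m W + mu *: (D *m (invmx W)^T) + Y *m (invmx W)^T by rewrite CE mulmxKV.
rewrite invmx_gramE // mulmxDr mulmx1 -scalemxAr mulmxA => E.
have {}E : C - X *m W = (Y + mu *: (D - C *m invmx W)) *m (invmx W)^T.
  rewrite mulmxDl -scalemxAl mulmxBl scalerBr.
  apply: (addIr (mu *: (C *m invmx W *m (invmx W)^T))); rewrite addrAC E.
  by rewrite -[RHS]addrA subrK -[X in X - _]addrA [LHS]addrC addKr addrC.
by rewrite E trmx_inv mulmxKV ?unitmx_tr.
Qed.

End WSVTStationarity.

Theorem theorem2 (R : realType) (m n : nat)
    (X : 'M[R]_(m, n)) (W : 'M[R]_n) (tau rho mu0 : R)
    (C D Y : nat -> 'M[R]_(m, n)) (mu : nat -> R)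
    (Coo Doo : 'M[R]_(m, n)) :
  W \in unitmx -> 0 < tau -> 1 < rho -> 0 < mu0 -> mu 0%N = mu0 ->
  wsvt_iteration X W tau rho C D Y mu ->
  C k @[k --> \oo] --> Coo ->
  D k @[k --> \oo] --> Doo ->
  Coo = Doo *m W /\
  exists a b : R, [/\ 0 <= a, 0 <= b &
    forall k : nat, (1 <= k)%N ->
      - (a / mu k.-1 ^+ 2)
        <= objective X W tau (C k) (D k) - objective X W tau Coo Doo
        <= b / mu k.-1].
Proof.
move=> Wu tau0 rho1 mu0_gt0 mu0E it Ccvg Dcvg.
have muP k : 0 < mu k.
  elim: k => [|k IH]; first by rewrite mu0E.
  by rewrite (wsvt_mu_eq it) mulr_gt0 // (lt_trans _ rho1).
pose del k := (mu k)^-1; pose B k := C k *m invmx W.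
pose H k := (C k - X *m W) *m W^T.
have del0 k : 0 < del k by rewrite invr_gt0.
have delS k : del k.+1 = del k / rho by rewrite /del (wsvt_mu_eq it) invfM mulrC.
have CB k : C k = B k *m W by rewrite /B mulmxKV.
have HE k : H k = (C k - X *m W) *m W^T by [].
have HS k : H k.+1 = Y k + mu k *: (D k - B k.+1).
  exact: C_update_stationary Wu (muP k) (wsvt_C_eq it k).
have svt k : [/\ nuclear_dual_pair tau (Y k.+1) (D k.+1),
    dual_ball tau (Y k.+1) & exists U S V, is_svd (D k.+1) U S V].
  have [U [S [V [sv DE]]]] := wsvt_D_eq it k.
  have YE : Y k.+1 = mu k *: (D k.+1 - (C k.+1 *m invmx W - (mu k)^-1 *: Y k)).
    rewrite (wsvt_Y_eq it) opprB [X in _ = _ *: X]addrCA [RHS]scalerDr scalerA divff ?gt_eqF //.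
    by rewrite scale1r.
  have [h1 h2 h3] := soft_threshold_dual tau0 (muP k) sv DE YE.
  by split=> //; exists U; exists (map_mx (soft_threshold (tau / mu k)) S); exists V.
have dualYD k : nuclear_dual_pair tau (Y k.+1) (D k.+1) by case: (svt k).
have ballY k : dual_ball tau (Y k).
  case: k => [|k]; last by case: (svt k).
  move=> a b; rewrite (wsvt_Y0 it) mul0mx -(scale0r a) mxinnerZr mul0r oppr0.
  by rewrite mulr_ge0 ?divr_ge0 ?addr_ge0 ?mxinner_ge0 // ltW.
have stepY k : D k.+1 - B k.+1 = del k *: (Y k.+1 - Y k).
  by rewrite (wsvt_Y_eq it) [X in _ *: X]addrC addKr scalerA mulVf ?gt_eqF // scale1r.
have stepD k : D k - D k.+1 = del k *: (H k.+1 - Y k.+1).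
  rewrite HS (wsvt_Y_eq it) -/(B k.+1) opprD addrACA subrr add0r -scalerBr.
  by rewrite scalerA mulVf ?gt_eqF // scale1r opprB addrA subrK.
have nuccvg : nuclear_norm (D k) @[k --> \oo] --> nuclear_norm Doo.
  rewrite -(@cvg_shiftS _ (fun k => nuclear_norm (D k))) /=.
  apply: nuclear_norm_cvg; first by move=> k; case: (svt k).
  by rewrite (@cvg_shiftS _ D).
split; first exact: (limits_coupled rho1 del0 delS CB ballY stepY Ccvg Dcvg).
have [a a0 lo] := objective_lower_bound tau0 rho1 del0 delS CB HE dualYD ballY
  stepY stepD Ccvg Dcvg nuccvg.
have [b b0 hi] := objective_upper_bound rho1 del0 delS CB HE dualYD ballY
  stepY stepD Ccvg Dcvg nuccvg.
exists a, b; split=> // -[//|k] _ /=; apply/andP; split.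
  by have := lo k; rewrite /del exprVn.
exact: hi k.
Qed.
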